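(* Assertion $\mathcal{D}(1/2,0)$ is true. That is: for all $\varepsilon>0$ there exist $\kappa,\eta>0$ such that for all $\delta>0$ the following holds. Let $(\mathbb{T},Y)_\delta$ be $\delta^\eta$ dense with $C_{KT\text{-}CW}(\mathbb{T})\leq\delta^{-\eta}$ and $C_{F\text{-}SW}(\mathbb{T})\leq\delta^{-\eta}$. Then $$\Big|\bigcup_{T\in\mathbb{T}}Y(T)\Big|\geq\kappa\,\delta^{\varepsilon}(\#\mathbb{T})|T|\big((\#\mathbb{T})|T|^{1/2}\big)^{-1/2}.$$
   Context: A $\delta$-tube in $\mathbb{R}^3$ is the $\delta$-neighbourhood of a unit line segment; $|\cdot|$ is Lebesgue measure and $|T|$ denotes the volume of a $\delta$-tube (comparable to $\delta^2$). Sets $U,V$ are essentially distinct if $|U\cap V|\leq\frac12\max(|U|,|V|)$. The notation $(\mathbb{T},Y)_\delta$ denotes a (nonempty) set $\mathbb{T}$ of pairwise essentially distinct $\delta$-tubes contained in the unit ball in $\mathbb{R}^3$, together with a shading, i.e. a measurable subset $Y(T)\subset T$ for each $T\in\mathbb{T}$. $(\mathbb{T},Y)_\delta$ is $\lambda$ dense if $\sum_{T\in\mathbb{T}}|Y(T)|\geq\lambda\sum_{T\in\mathbb{T}}|T|$. $C_{KT\text{-}CW}(\mathbb{T})$ is the infimum of all $C>0$ such that $\#\{T\in\mathbb{T}: T\subset W\}\leq C|W||T|^{-1}$ for all convex sets $W\subset\mathbb{R}^3$. A slab is the intersection of the unit ball with a (thickened) neighbourhood of a plane. $C_{F\text{-}SW}(\mathbb{T})$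 is the infimum of all $C>0$ such that $\#\{T\in\mathbb{T}:T\subset W\}\leq C|W|(\#\mathbb{T})$ for all slabs $W\subset\mathbb{R}^3$. *)

(* Defs.v *)
From HB Require Import structures.
From mathcomp Require Import all_boot all_order all_algebra.
From mathcomp Require Import all_classical all_reals all_analysis.

Set Implicit Arguments.
Unset Strict Implicit.
Unset Printing Implicit Defensive.

Import Order.TTheory GRing.Theory Num.Theory.
Import numFieldNormedType.Exports.

Local Open Scope classical_set_scope.
Local Open Scope ring_scope.

(* R^o makes the product an R-module with coordinatewise operations.  Its
   library norm is the sup norm, hence the Euclidean dot product and norm below.
   R3meas is the same type with the product Borel sigma-algebra on which
   [lebesgue_measure] is defined. *)
Notation R3 R := (R^o * R^o * R^o)%type.
Notation R3meas R :=
  (measurableTypeR R * measurableTypeR R * measurableTypeR R)%type.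

Definition dot3 (R : realType) (x y : R3 R) : R :=
  x.1.1 * y.1.1 + x.1.2 * y.1.2 + x.2 * y.2.

Definition enorm (R : realType) (x : R3 R) : R := Num.sqrt (dot3 x x).

Definition borel_lebesgue3 (R : realType) : set (R3meas R) -> \bar R :=
  ((lebesgue_measure \x lebesgue_measure) \x lebesgue_measure)%E.

HB.instance Definition _ (R : realType) := Measure.on (@borel_lebesgue3 R).

(* Lebesgue outer measure on R^3.  It is Lebesgue measure on the sets that are
   measurable in the sense of [lebesgue_measurable3]; these need not be Borel
   (a convex set, for instance, need not be). *)
Definition vol (R : realType) : set (R3 R) -> \bar R :=
  @mu_ext _ (R3meas R) R (@borel_lebesgue3 R).

HB.instance Definition _ (R : realType) :=
  OuterMeasure.copy (@vol R) (@mu_ext _ (R3meas R) R (@borel_lebesgue3 R)).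

Definition lebesgue_measurable3 (R : realType) (A : set (R3 R)) : Prop :=
  (@vol R).-caratheodory A.

Definition unit_ball (R : realType) : set (R3 R) := [set x | enorm x <= 1].

Definition thicken (R : realType) (r : R) (A : set (R3 R)) : set (R3 R) :=
  [set x | exists2 y, A y & enorm (x - y) < r].

(* The segment from a to a + v. *)
Definition segment3 (R : realType) (a v : R3 R) : set (R3 R) :=
  [set x | exists2 t : R, 0 <= t <= 1 & x = a + t *: v].

Definition is_tube (R : realType) (delta : R) (T : set (R3 R)) : Prop :=
  exists a v : R3 R, enorm v = 1 /\ T = thicken delta (segment3 a v).

(* |T|: all delta-tubes are congruent, so this is the volume of any of them. *)
Definition tube_vol (R : realType) (delta : R) : R :=
  fine (vol (thicken delta (segment3 (0 : R3 R) ((0, 0), 1)))).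

Definition plane (R : realType) (n : R3 R) (c : R) : set (R3 R) :=
  [set x | dot3 n x = c].

Definition is_slab (R : realType) (W : set (R3 R)) : Prop :=
  exists (n : R3 R) (c r : R),
    [/\ n != 0, 0 < r & W = @unit_ball R `&` thicken r (plane n c)].

Definition ess_distinct (R : realType) (U V : set (R3 R)) : Prop :=
  (vol (U `&` V) <= (2^-1)%:E * maxe (vol U) (vol V))%E.

(* (TT, Y)_delta.  Only the values of Y on TT matter. *)
Definition shaded_tubes (R : realType) (delta : R) (TT : set (set (R3 R)))
    (Y : set (R3 R) -> set (R3 R)) : Prop :=
  [/\ TT !=set0,
      forall T, TT T -> is_tube delta T /\ T `<=` @unit_ball R,
      forall U V, TT U -> TT V -> U <> V -> ess_distinct U V &
      forall T, TT T -> lebesgue_measurable3 (Y T) /\ Y T `<=` T].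

Definition dense_shading (R : realType) (lambda : R) (TT : set (set (R3 R)))
    (Y : set (R3 R) -> set (R3 R)) : Prop :=
  (lambda%:E * (\esum_(T in TT) vol T) <= \esum_(T in TT) vol (Y T))%E.

Definition tubes_in (R : realType) (TT : set (set (R3 R))) (W : set (R3 R)) :
  set (set (R3 R)) := [set T | TT T /\ T `<=` W].

(* The infimum of the empty set is +oo. *)
Definition C_KT_CW (R : realType) (delta : R) (TT : set (set (R3 R))) : \bar R :=
  ereal_inf [set C%:E | C in [set C : R | 0 < C /\
    forall W : set (R3 R), convex_set W ->
      (counting (tubes_in TT W) <=
         C%:E * vol W * ((tube_vol delta)^-1)%:E)%E]].

Definition C_F_SW (R : realType) (TT : set (set (R3 R))) : \bar R :=
  ereal_inf [set C%:E | C in [set C : R | 0 < C /\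
    forall W : set (R3 R), is_slab W ->
      (counting (tubes_in TT W) <= C%:E * vol W * counting TT)%E]].

(* Main.v *)
Require Import Defs.
From HB Require Import structures.
From mathcomp Require Import all_boot all_order all_algebra.
From mathcomp Require Import all_classical all_reals all_analysis.
From mathcomp Require Import measurable_realfun.
From mathcomp Require Import ring lra zify.

(* This is Wolff's hairbrush argument.

   Write N for the number of tubes, mu for the typical number of shaded tubes
   through a point of the union, and theta for the typical angle between two of
   them; mu and theta are fixed by dyadic pigeonholing, at a logarithmic cost.
   Some tube T0 then meets about mu theta / delta tubes, its hairbrush, at angle
   about theta.  By the Katz-Tao condition for convex sets these are essentially
   disjoint away from T0: two that meet there span with T0 nearly the same
   plane, and a plate contains few tubes.  So the hairbrush has volume at least
   about mu theta delta.  On the other hand it consists of points of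
   multiplicity about mu, all of whose tubes at angle at most theta lie in one
   slab of thickness about theta; by the Frostman condition for slabs there are
   at most about theta N of these, whence
   mu * (mu theta delta) <= theta N delta^2, that is mu^2 <= N delta.  Since the
   union has volume about N delta^2 / mu, this is the claim.

   Angles are measured by the norm of the cross product, which does not depend
   on the orientation of the axes.  Volumes are bounded above through coverings
   by cubes, and below through disjoint cubes along the axis of a tube, so that
   rotation invariance of Lebesgue measure is not needed. *)

Set Implicit Arguments.
Unset Strict Implicit.
Unset Printing Implicit Defensive.

Import Order.TTheory GRing.Theory Num.Theory.
Import numFieldNormedType.Exports.

Local Open Scope classical_set_scope.
Local Open Scope ring_scope.

(** * Vectors of R^3 *)

Definition cross3 (R : realType) (x y : R3 R) : R3 R :=
  ((x.1.2 * y.2 - x.2 * y.1.2, x.2 * y.1.1 - x.1.1 * y.2),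
   x.1.1 * y.1.2 - x.1.2 * y.1.1).

Section Vectors.
Variable R : realType.
Implicit Types x y z u v w n : R3 R.

Lemma dotC x y : dot3 x y = dot3 y x.
Proof. by rewrite /dot3; ring. Qed.

Lemma dotDl x y z : dot3 (x + y) z = dot3 x z + dot3 y z.
Proof. by rewrite /dot3 /=; ring. Qed.

Lemma dotBl x y z : dot3 (x - y) z = dot3 x z - dot3 y z.
Proof. by rewrite /dot3 /=; ring. Qed.

Lemma dotZl a x y : dot3 (a *: x) y = a * dot3 x y.
Proof. by rewrite /dot3 /= /GRing.scale /=; ring. Qed.

Lemma dotDr x y z : dot3 x (y + z) = dot3 x y + dot3 x z.
Proof. by rewrite dotC dotDl !(dotC x). Qed.

Lemma dotBr x y z : dot3 x (y - z) = dot3 x y - dot3 x z.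
Proof. by rewrite dotC dotBl !(dotC x). Qed.

Lemma dotZr a x y : dot3 x (a *: y) = a * dot3 x y.
Proof. by rewrite dotC dotZl (dotC x). Qed.

Lemma crossDl x y z : cross3 (x + y) z = cross3 x z + cross3 y z.
Proof. by congr (_, _, _); rewrite /=; ring. Qed.

Lemma crossZl a x y : cross3 (a *: x) y = a *: cross3 x y.
Proof. by congr (_, _, _); rewrite /= /GRing.scale /=; ring. Qed.

Lemma crossxx x : cross3 x x = 0.
Proof. by congr (_, _, _); rewrite /=; ring. Qed.

Lemma crossBl x y z : cross3 (x - y) z = cross3 x z - cross3 y z.
Proof. by congr (_, _, _); rewrite /=; ring. Qed.

(** Lagrange's identity. For unit vectors it makes the norm of the cross product the sine of the
    angle between them. *)
Lemma lagrange_cross u v :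
  dot3 (cross3 u v) (cross3 u v) = dot3 u u * dot3 v v - dot3 u v ^+ 2.
Proof. by rewrite /dot3 /=; ring. Qed.

Lemma dot_crossl u v : dot3 u (cross3 u v) = 0.
Proof. by rewrite /dot3 /=; ring. Qed.

Lemma dot_crossr u v : dot3 v (cross3 u v) = 0.
Proof. by rewrite /dot3 /=; ring. Qed.

(** The squared volume of a parallelepiped is its Gram determinant; with [v] and [w] orthonormal
    this turns into [parseval]. *)
Lemma gram3 u v w : dot3 u (cross3 v w) ^+ 2 =
   dot3 u u * dot3 v v * dot3 w w + 2 * dot3 u v * dot3 v w * dot3 u w
   - dot3 u u * dot3 v w ^+ 2 - dot3 v v * dot3 u w ^+ 2
   - dot3 w w * dot3 u v ^+ 2.
Proof. by rewrite /dot3 /=; ring. Qed.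

Lemma dot_ge0 x : 0 <= dot3 x x.
Proof. by rewrite /dot3 -!expr2 !addr_ge0 // sqr_ge0. Qed.

Lemma enorm_ge0 x : 0 <= enorm x.
Proof. exact: sqrtr_ge0. Qed.

Lemma enorm_sqr x : enorm x ^+ 2 = dot3 x x.
Proof. by rewrite sqr_sqrtr // dot_ge0. Qed.

Lemma enorm_eq1 x : enorm x = 1 -> dot3 x x = 1.
Proof. by rewrite -enorm_sqr => ->; rewrite expr1n. Qed.

Lemma enormP x (c : R) : 0 <= c -> (enorm x <= c) = (dot3 x x <= c ^+ 2).
Proof. by move=> c0; rewrite -enorm_sqr ler_sqr // nnegrE enorm_ge0. Qed.

Lemma enormZ a x : enorm (a *: x) = `|a| * enorm x.
Proof.
by rewrite /enorm dotZl dotZr mulrA -expr2 sqrtrM ?sqr_ge0 // sqrtr_sqr.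
Qed.

Lemma cauchy_schwarz x y : `|dot3 x y| <= enorm x * enorm y.
Proof.
rewrite -ler_sqr ?nnegrE ?mulr_ge0 ?enorm_ge0 // real_normK ?num_real //.
by rewrite exprMn !enorm_sqr -subr_ge0 -lagrange_cross dot_ge0.
Qed.

Lemma enorm_cross x y : enorm (cross3 x y) <= enorm x * enorm y.
Proof.
rewrite enormP ?mulr_ge0 ?enorm_ge0 // lagrange_cross exprMn !enorm_sqr.
by rewrite gerBl sqr_ge0.
Qed.

Lemma enormD x y : enorm (x + y) <= enorm x + enorm y.
Proof.
rewrite enormP ?addr_ge0 ?enorm_ge0 // sqrrD !enorm_sqr dotDl !dotDr (dotC y x).
have := ler_norm (dot3 x y); have := cauchy_schwarz x y; lra.
Qed.

Lemma enormB x y : enorm (x - y) <= enorm x + enorm y.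
Proof.
apply: le_trans (enormD _ _) _.
by rewrite -[in X in _ + X]scaleN1r enormZ normrN1 mul1r.
Qed.

Lemma enorm_coord x :
  [/\ `|x.1.1| <= enorm x, `|x.1.2| <= enorm x & `|x.2| <= enorm x].
Proof.
have H t : t ^+ 2 <= dot3 x x -> `|t| <= enorm x.
  by rewrite -enorm_sqr -[t ^+ 2]real_normK ?num_real // ler_sqr
    // nnegrE ?enorm_ge0.
have h t : 0 <= t * t :> R by rewrite -expr2 sqr_ge0.
have := h x.1.1; have := h x.1.2; have := h x.2 => a b c.
by split; apply: H; rewrite /dot3; lra.
Qed.

Lemma parseval v n u : enorm v = 1 -> enorm n = 1 -> dot3 v n = 0 ->
  dot3 u u = dot3 u v ^+ 2 + dot3 u n ^+ 2 + dot3 u (cross3 v n) ^+ 2.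
Proof. by move=> /enorm_eq1 v1 /enorm_eq1 n1 vn; rewrite gram3 v1 n1 vn; ring. Qed.

Lemma enorm_cross_orth v n : enorm v = 1 -> enorm n = 1 -> dot3 v n = 0 ->
  enorm (cross3 v n) = 1.
Proof.
by move=> /enorm_eq1 v1 /enorm_eq1 n1 vn; rewrite /enorm lagrange_cross v1 n1 vn;
  rewrite expr0n mulr1 subr0 sqrtr1.
Qed.

(** For a unit vector [v], the norm of [cross3 u v] is the length of the whole component of [u]
    orthogonal to [v], and [n] is only one direction in that plane. *)
Lemma dot_le_cross v n u : enorm v = 1 -> enorm n = 1 -> dot3 v n = 0 ->
  `|dot3 u n| <= enorm (cross3 u v).
Proof.
move=> v1 n1 vn; rewrite -ler_sqr ?nnegrE ?enorm_ge0 // real_normK ?num_real //.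
rewrite enorm_sqr lagrange_cross (parseval u v1 n1 vn) (enorm_eq1 v1) mulr1.
have := sqr_ge0 (dot3 u (cross3 v n)); lra.
Qed.

Lemma orth_unit v : enorm v = 1 -> exists2 n, enorm n = 1 & dot3 v n = 0.
Proof.
move=> v1; suff [w w0 vw] : exists2 w, dot3 w w != 0 & dot3 v w = 0.
  exists ((enorm w)^-1 *: w); last by rewrite dotZr vw mulr0.
  have e0 : enorm w != 0 by apply: contra_neq w0; rewrite -enorm_sqr => ->;
    rewrite expr0n.
  by rewrite enormZ normfV ger0_norm ?enorm_ge0 // mulVf.
(* [v] cannot be parallel to both of the first two coordinate axes: the squares of two of its
   coordinates would be [1]. *)
have [h|h] := eqVneq (dot3 (cross3 v ((1, 0), 0)) (cross3 v ((1, 0), 0))) 0;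
  last by exists (cross3 v ((1, 0), 0)) => //; rewrite dot_crossl.
exists (cross3 v ((0, 1), 0)); last by rewrite dot_crossl.
move: h; have := enorm_eq1 v1; rewrite !lagrange_cross => ->.
move: (enorm_eq1 v1); rewrite /dot3 /= => h1 h2; apply/eqP => h3.
have := sqr_ge0 v.1.1; have := sqr_ge0 v.1.2; have := sqr_ge0 v.2; nra.
Qed.

End Vectors.

(** * Lebesgue measure *)

Section Volume.
Variable R : realType.
Implicit Types x y z u v w n p : R3 R.
Implicit Types A B : set (R3 R).

Lemma le_vol A B : A `<=` B -> (vol A <= vol B)%E.
Proof. exact: le_outer_measure. Qed.

Lemma vol_ge0 A : (0 <= vol A)%E.
Proof. exact: outer_measure_ge0. Qed.

Lemma vol_setU A B : (vol (A `|` B) <= vol A + vol B)%E.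
Proof. exact: outer_measureU2. Qed.

Lemma vol_bigU_le (I : Type) (s : seq I) (P : pred I) (F : I -> set (R3 R)) :
  (vol (\big[setU/set0]_(i <- s | P i) F i) <= \sum_(i <- s | P i) vol (F i))%E.
Proof.
elim/big_ind2: _ => [|A a B b hA hB|//]; first by rewrite outer_measure0.
by apply: le_trans (vol_setU _ _) _; exact: leeD.
Qed.

(** The Caratheodory condition of one set, tested on the whole union, splits this set off; induction
    on the list does the rest. *)
Lemma vol_bigU (I : choiceType) (s : seq I) (P : pred I) (F : I -> set (R3 R)) :
  uniq s -> (forall i, lebesgue_measurable3 (F i)) ->
  (forall i j x, F i x -> F j x -> i = j) ->
  vol (\big[setU/set0]_(i <- s | P i) F i) = (\sum_(i <- s | P i) vol (F i))%E.
Proof.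
move=> us mF dF; elim: s us => [_|i s IH /= /andP[is_ /IH {}IH]].
  by rewrite !big_nil outer_measure0.
rewrite !big_cons; case: ifP => // Pi; rewrite (mF i) -IH.
congr (vol _ + vol _)%E; first by apply/setIidPr; exact: subsetUl.
rewrite setIUl setICr set0U; apply/setIidPl => x + Fi.
rewrite -bigcup_seq_cond => -[j /= /andP[js _] Fj].
by move: is_; rewrite (dF _ _ _ Fi Fj) js.
Qed.

Definition cube p (r : R) : set (R3 R) :=
  [set x | [/\ `|x.1.1 - p.1.1| <= r, `|x.1.2 - p.1.2| <= r & `|x.2 - p.2| <= r]].

Lemma cubeE p r : cube p r =
  (`[p.1.1 - r, p.1.1 + r] `*` `[p.1.2 - r, p.1.2 + r]) `*` `[p.2 - r, p.2 + r].
Proof.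
apply/seteqP; split => -[[x1 x2] x3]; rewrite /cube /= !in_itv /= !ler_distl.
  by move=> [-> -> ->].
by move=> [[-> ->] ->].
Qed.

Lemma measurable_cube p r : measurable (cube p r : set (R3meas R)).
Proof. by rewrite cubeE; apply: measurableX; first apply: measurableX. Qed.

Lemma cube_cara p r : lebesgue_measurable3 (cube p r).
Proof. have := @caratheodory_measurable_mu_ext _ R (R3meas R) (@borel_lebesgue3 R) _
  (measurable_cube p r).
exact. Qed.

Lemma vol_cube p r : 0 <= r -> vol (cube p r) = ((2 * r) ^+ 3)%:E.
Proof.
move=> r0; rewrite /vol measurable_mu_extE; last exact: measurable_cube.
rewrite /borel_lebesgue3 cubeE.
have l (c : R) : lebesgue_measure (`[c - r, c + r] : set (measurableTypeR R)) = (2 * r)%:E.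
  rewrite lebesgue_measure_itv /= lte_fin; case: ltP => h.
    by rewrite -EFinB; congr (_%:E); ring.
  by congr (_%:E); lra.
have m (c : R) : measurable (`[c - r, c + r] : set (measurableTypeR R)).
  exact: measurable_itv.
have -> : (2 * r) ^+ 3 = (2 * r) * (2 * r) * (2 * r) by ring.
rewrite !EFinM; etransitivity.
  exact: (product_measure1E _ _ (measurableX (m p.1.1) (m p.1.2)) (m p.2)).
congr (_ * _)%E; last exact: l.
etransitivity; first exact: (product_measure1E _ _ (m p.1.1) (m p.1.2)).
by congr (_ * _)%E; exact: l.
Qed.

Lemma vol_unit_ball A : A `<=` @unit_ball R -> (vol A <= 8%:E)%E.
Proof.
move=> AB; have -> : 8 = (2 * 1) ^+ 3 :> R by ring.
rewrite -(vol_cube 0 ler01); apply: le_vol => x /AB /= x1.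
by have [? ? ?] := enorm_coord x; split; rewrite subr0 (le_trans _ x1).
Qed.

Lemma fin_vol A : A `<=` @unit_ball R -> vol A \is a fin_num.
Proof. by move/vol_unit_ball => h; rewrite ge0_fin_numE ?vol_ge0 // (le_lt_trans h) ?ltry. Qed.

Definition incidence (J : finType) (Z : J -> set (R3 R)) x : {set J} :=
  [set j | `[< Z j x >]]%SET.

Lemma in_incidence (J : finType) (Z : J -> set (R3 R)) x j :
  reflect (Z j x) (j \in incidence Z x).
Proof. by rewrite inE; exact: asboolP. Qed.

Lemma incidence_cara (J : finType) (Z : J -> set (R3 R)) (P : pred {set J}) :
  (forall j, lebesgue_measurable3 (Z j)) ->
  lebesgue_measurable3 [set x | P (incidence Z x)].
Proof.
move=> mZ; have mat S : lebesgue_measurable3 [set x | incidence Z x = S].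
  have -> : [set x | incidence Z x = S] =
      \bigcap_(j in [set: J]) (if j \in S then Z j else ~` Z j).
    apply/seteqP; split => [x <- j _|x h].
      by case: ifPn => /in_incidence.
    apply/finset.setP => j; have /= := h j I.
    by case: (j \in S) => hj; [|apply/negbTE]; apply/in_incidence.
  have := @fin_bigcap_measurable _ (caratheodory_type (@vol R)) J setT
    (fun j => if j \in S then Z j else ~` Z j).
  apply; first exact: finite_finset.
  move=> j _; case: (j \in S); first exact: mZ.
  by apply: caratheodory_measurable_setC; exact: mZ.
have -> : [set x | P (incidence Z x)] =
    \bigcup_(S in [set S | P S]) [set x | incidence Z x = S].
  apply/seteqP; split => x /=; first by exists (incidence Z x).
  by move=> [S /= PS ->].
have := @fin_bigcup_measurable _ (caratheodory_type (@vol R)) {set J} [set S | P S]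
  (fun S => [set x | incidence Z x = S]).
by apply; [exact: finite_finset|move=> S _; exact: mat].
Qed.

(** The sets on which [incidence Z] is constant are disjoint and measurable, so integrals of
    functions of the multiplicity become finite sums. The atom of the empty set is the complement of
    all [Z j] and has infinite measure, which is why [P] has to exclude it. *)
Lemma atoms (J : finType) (Z : J -> set (R3 R)) :
  (forall j, lebesgue_measurable3 (Z j)) -> (forall j, Z j `<=` @unit_ball R) ->
  exists2 w : {set J} -> R, (forall S, 0 <= w S) &
  forall P : pred {set J}, ~~ P finset.set0 ->
    vol [set x | P (incidence Z x)] = (\sum_(S | P S) w S)%:E.
Proof.
move=> mZ bZ; pose at_ S := [set x | incidence Z x == S].
have mat S : lebesgue_measurable3 (at_ S) by exact: (incidence_cara (pred1 S) mZ).
have bat S : S != finset.set0 -> at_ S `<=` @unit_ball R.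
  case/finset.set0Pn => j jS x /eqP xS; apply: (bZ j).
  by apply/in_incidence; rewrite xS.
exists (fun S => fine (vol (at_ S))) => [S|P P0]; first by rewrite fine_ge0 // vol_ge0.
rewrite -sumEFin.
under [RHS]eq_bigr => S PS.
  rewrite fineK; last by apply/fin_vol/bat; apply: contraNneq P0 => <-.
  over.
rewrite -vol_bigU ?index_enum_uniq //; last first.
  by move=> S S' x; rewrite /at_ /= => /eqP <- /eqP.
congr (vol _); rewrite -bigcup_seq_cond; apply/seteqP; split => x /=.
  by move=> Px; exists (incidence Z x); rewrite /at_ //= mem_index_enum.
by rewrite /at_ => -[S /=]; rewrite mem_index_enum => PS /eqP ->.
Qed.

(** Cauchy-Schwarz for the multiplicity function on the union: the first sum is its integral, the
    double sum the integral of its square. On atoms the multiplicity is the cardinality [c S]. *)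
Lemma cauchy_schwarz_union (J : finType) (Z : J -> set (R3 R)) (V : R) :
  (forall j, lebesgue_measurable3 (Z j)) -> (forall j, Z j `<=` @unit_ball R) ->
  (vol (\bigcup_j Z j) <= V%:E)%E ->
  (\sum_j fine (vol (Z j))) ^+ 2 <=
    V * \sum_j \sum_i fine (vol (Z j `&` Z i)).
Proof.
move=> mZ bZ ZV; have [w w0 hw] := atoms mZ bZ.
have wZ j : fine (vol (Z j)) = \sum_(S : {set J}) w S * (j \in S)%:R.
  have -> : Z j = [set x | j \in incidence Z x].
    by apply/seteqP; split => x /= /in_incidence.
  rewrite (hw (fun S => j \in S)) ?inE // big_mkcond /=.
  by apply: eq_bigr => S _; case: (j \in S); rewrite ?mulr1 ?mulr0.
have wZZ j i : fine (vol (Z j `&` Z i)) =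
    \sum_(S : {set J}) w S * ((j \in S)%:R * (i \in S)%:R).
  have -> : Z j `&` Z i = [set x | let S := incidence Z x in
      (j \in S) && (i \in S)].
    apply/seteqP; split => x /=.
      by move=> [? ?]; apply/andP; split; apply/in_incidence.
    by move/andP => [/in_incidence ? /in_incidence].
  rewrite (hw (fun S => (j \in S) && (i \in S))) ?inE // big_mkcond /=.
  by apply: eq_bigr => S _; do 2!case: (_ \in S); rewrite ?mulr1 ?mulr0.
have wU : \sum_(S : {set J} | S != finset.set0) w S <= V.
  rewrite -lee_fin -hw ?eqxx //; apply: le_trans ZV; apply: le_vol => x /=.
  by move=> /finset.set0Pn[j] /in_incidence; exists j.
pose c (S : {set J}) : R := #|S|%:R.
have sc (S : {set J}) : \sum_j (j \in S)%:R = c S.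
  by rewrite /c -sum1_card natr_sum [RHS]big_mkcond /=; apply: eq_bigr => j _; case: (j \in S).
have -> : \sum_j fine (vol (Z j)) = \sum_(S : {set J} | S != finset.set0) w S * c S.
  under eq_bigr => j _ do rewrite wZ.
  rewrite exchange_big /= [RHS]big_mkcond /=.
  apply: eq_bigr => S _; rewrite -big_distrr /= sc; case: eqP => //= ->.
  by rewrite /c cards0 mulr0.
have -> : \sum_j \sum_i fine (vol (Z j `&` Z i)) =
    \sum_(S : {set J} | S != finset.set0) w S * c S ^+ 2.
  have E j : \sum_i fine (vol (Z j `&` Z i)) =
      \sum_(S : {set J}) w S * ((j \in S)%:R * c S).
    rewrite (eq_bigr _ (fun i _ => wZZ j i)) exchange_big /=.
    by apply: eq_bigr => S _; rewrite -!big_distrr /= sc.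
  rewrite (eq_bigr _ (fun j _ => E j)) exchange_big /= [RHS]big_mkcond /=.
  apply: eq_bigr => S _; rewrite -big_distrr -big_distrl /= sc -expr2.
  by case: eqP => //= ->; rewrite /c cards0 expr0n mulr0.
set W := \sum_(S | _) w S in wU; set A := \sum_(S | _) _; set B := \sum_(S | _) _.
have B0 : 0 <= B by apply: sumr_ge0 => S _; rewrite mulr_ge0 ?sqr_ge0.
suff h : A ^+ 2 <= W * B by apply: le_trans h _; exact: ler_wpM2r.
(* The weighted variance about any [t] is nonnegative; below, [t] is the mean [A / W], where this
   quadratic is smallest. *)
have q t : 0 <= W * t ^+ 2 - 2 * t * A + B.
  have -> : W * t ^+ 2 - 2 * t * A + B =
     \sum_(S : {set J} | S != finset.set0) w S * (t - c S) ^+ 2.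
    rewrite /W /A /B big_distrl big_distrr /= -sumrN -!big_split /=.
    by apply: eq_bigr => S _; ring.
  by apply: sumr_ge0 => S _; rewrite mulr_ge0 ?sqr_ge0.
have W0 : 0 <= W by exact: sumr_ge0.
have [W00|Wp] := eqVneq W 0.
  suff -> : A = 0 by rewrite expr0n W00 mul0r.
  rewrite /A big1 // => S S0; suff -> : w S = 0 by rewrite mul0r.
  by move/eqP: W00; rewrite psumr_eq0 // => /allP /(_ S);
    rewrite mem_index_enum S0 => /(_ isT) /eqP.
have {}Wp : 0 < W by rewrite lt_def Wp.
have := q (A / W); rewrite -(pmulr_rge0 _ Wp).
have -> : W * (W * (A / W) ^+ 2 - 2 * (A / W) * A + B) = W * B - A ^+ 2.
  by field; rewrite gt_eqF.
by rewrite subr_ge0.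
Qed.
End Volume.

(** * Boxes *)

Definition tube (R : realType) (d : R) (a v : R3 R) := thicken d (segment3 a v).

Section Tubes.
Variable R : realType.
Implicit Types x y z u v w n p a : R3 R.
Implicit Types A B : set (R3 R).

Lemma perp_part d v : enorm v = 1 ->
  enorm (d - dot3 d v *: v) = enorm (cross3 d v).
Proof.
move=> /enorm_eq1 v1; congr (Num.sqrt _).
by rewrite lagrange_cross dotBl !dotBr !dotZl !dotZr v1 (dotC v d); ring.
Qed.

(** Split [d] into its component along [v] and an orthogonal rest. The rest has length
    [enorm (cross3 d v)] and perturbs the product with the unit vector [w] by no more than that. *)
Lemma cross_split d v w : enorm v = 1 -> enorm w = 1 ->
  `|enorm (cross3 d w) - `|dot3 d v| * enorm (cross3 v w)| <= enorm (cross3 d v).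
Proof.
move=> v1 w1; set e := d - dot3 d v *: v.
have ee : enorm (cross3 e w) <= enorm (cross3 d v).
  by apply: le_trans (enorm_cross _ _) _; rewrite w1 mulr1 perp_part.
have h1 : cross3 d w = dot3 d v *: cross3 v w + cross3 e w.
  by rewrite -crossZl -crossDl; congr (cross3 _ _); rewrite /e addrC subrK.
have h2 : dot3 d v *: cross3 v w = cross3 d w - cross3 e w by rewrite h1 addrK.
have := enormD (dot3 d v *: cross3 v w) (cross3 e w); rewrite -h1.
have := enormB (cross3 d w) (cross3 e w); rewrite -h2 enormZ.
by rewrite ler_norml => i1 i2; apply/andP; split; lra.
Qed.

(** This is what makes transversal tubes meet in a short piece: a vector nearly parallel to both [v]
    and [w] has length at most inversely proportional to their angle. *)
Lemma dot_cross_bound d v w : enorm v = 1 -> enorm w = 1 ->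
  `|dot3 d v| * enorm (cross3 v w) <= enorm (cross3 d w) + enorm (cross3 d v).
Proof. by move=> v1 w1; have := cross_split d v1 w1; rewrite ler_norml => /andP[]; lra. Qed.

Lemma cross_triangle u v w : enorm u = 1 -> enorm v = 1 -> enorm w = 1 ->
  enorm (cross3 u w) <= enorm (cross3 u v) + enorm (cross3 v w).
Proof.
move=> u1 v1 w1; have := cross_split u v1 w1; rewrite ler_norml => /andP[_].
have := cauchy_schwarz u v; rewrite u1 v1 mulr1 => h.
have := ler_wpM2r (enorm_ge0 (cross3 v w)) h; lra.
Qed.

Lemma crossC_norm u v : enorm (cross3 u v) = enorm (cross3 v u).
Proof. by congr (Num.sqrt _); rewrite /dot3 /=; ring. Qed.

(** The box may be tilted against the coordinate axes. It is covered by axis-parallel cubes centred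
    on a grid that follows its own frame, with the smallest half side [h] as spacing. *)
Lemma vol_box v n p A (r1 r2 r3 : R) : enorm v = 1 -> enorm n = 1 ->
  dot3 v n = 0 -> 0 < r1 -> 0 < r2 -> 0 < r3 ->
  (forall x, A x -> [/\ `|dot3 (x - p) v| <= r1, `|dot3 (x - p) n| <= r2 &
      `|dot3 (x - p) (cross3 v n)| <= r3]) ->
  (vol A <= (12 ^+ 3 * (r1 * r2 * r3))%:E)%E.
Proof.
move=> v1 n1 vn r10 r20 r30 hA; set m := cross3 v n.
pose h := Num.min r1 (Num.min r2 r3).
have h0 : 0 < h by rewrite !lt_min r10 r20.
have [h1 h2 h3] : [/\ h <= r1, h <= r2 & h <= r3].
  by rewrite !ge_min !lexx !orbT.
pose N r := (Num.truncn (2 * r / h)).+1.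
pose g (i : 'I_(N r1) * 'I_(N r2) * 'I_(N r3)) :=
  p + (i.1.1%:R * h - r1) *: v + (i.1.2%:R * h - r2) *: n + (i.2%:R * h - r3) *: m.
have idx (t r : R) : `|t| <= r -> exists i : 'I_(N r), `|t - (i%:R * h - r)| <= h.
  rewrite ler_norml => /andP[t1 t2].
  have tr : 0 <= (t + r) / h by apply: divr_ge0; [lra|exact: ltW].
  have /truncn_itv /andP[k1 k2] := tr.
  have kN : (Num.truncn ((t + r) / h) < N r)%N.
    by rewrite ltnS; apply: le_truncn; rewrite ler_pM2r ?invr_gt0 //; lra.
  exists (Ordinal kN) => /=; move: k1 k2; rewrite ler_pdivlMr // ltr_pdivrMr //.
  by rewrite -natr1 => k1 k2; rewrite ler_norml; apply/andP; split; lra.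
have cov : A `<=` \big[setU/set0]_i cube (g i) (2 * h).
  move=> x /hA[/idx[i1 e1] /idx[i2 e2] /idx[i3 e3]].
  rewrite -bigcup_seq; exists (i1, i2, i3); first by rewrite /= mem_index_enum.
  have m1 : enorm m = 1 by exact: enorm_cross_orth.
  have nm : dot3 n m = 0 by rewrite dot_crossr.
  have vm : dot3 v m = 0 by rewrite dot_crossl.
  have [E1 E2 E3] : [/\ `|dot3 (x - g (i1, i2, i3)) v| <= h,
      `|dot3 (x - g (i1, i2, i3)) n| <= h & `|dot3 (x - g (i1, i2, i3)) m| <= h].
    split; [move: e1|move: e2|move: e3]; congr (`| _ | <= _);
      rewrite /g /= !(dotBl, dotDl, dotZl) ?(dotC n v) ?(dotC m v) ?(dotC m n)
        ?vn ?vm ?nm ?(enorm_eq1 v1) ?(enorm_eq1 n1) ?(enorm_eq1 m1); ring.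
  (* Three orthonormal components of size at most [h] give norm at most [sqrt 3 * h], rounded up to
     [2 * h]. *)
  have xg : enorm (x - g (i1, i2, i3)) <= 2 * h.
    rewrite enormP ?mulr_ge0 ?(ltW h0) // (parseval _ v1 n1 vn) -/m.
    have s t : `|t| <= h -> t ^+ 2 <= h ^+ 2.
      by move=> th; rewrite -[t ^+ 2]real_normK ?num_real // ler_sqr ?nnegrE ?normr_ge0 ?(ltW h0).
    have := s _ E1; have := s _ E2; have := s _ E3; rewrite exprMn.
    have := sqr_ge0 h; lra.
  have [c1 c2 c3] := enorm_coord (x - g (i1, i2, i3)); split;
    by apply: le_trans xg.
apply: le_trans (le_vol cov) _; apply: le_trans (vol_bigU_le _ _ _) _.
under eq_bigr => i _ do rewrite vol_cube ?mulr_ge0 ?(ltW h0) //.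
rewrite sumEFin lee_fin big_const iter_addr addr0 -[X in X <= _]mulr_natl.
rewrite !card_prod !card_ord !natrM.
have NN r : h <= r -> (N r)%:R <= 3 * r / h.
  move=> hr; have r0 : 0 <= 2 * r / h by rewrite divr_ge0 ?mulr_ge0 ?(ltW h0) // (le_trans (ltW h0)).
  rewrite /N -natr1; have /andP[+ _] := truncn_itv r0.
  have : 1 <= r / h by rewrite ler_pdivlMr // mul1r.
  rewrite -!mulrA; lra.
(* At most [3 * r / h] grid points per direction and cubes of side [4 * h]: the constant is
   [(3 * 4) ^+ 3]. *)
apply: (@le_trans _ _ ((3 * r1 / h) * (3 * r2 / h) * (3 * r3 / h) * (2 * (2 * h)) ^+ 3)).
  apply: ler_wpM2r; first by rewrite exprn_ge0 // !mulr_ge0 // ltW.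
  by apply: ler_pM; rewrite ?mulr_ge0 ?NN //; apply: ler_pM; rewrite ?NN.
rewrite le_eqVlt; apply/orP; left; apply/eqP; field; exact: lt0r_neq0.
Qed.
End Tubes.

(** * Tubes, slabs and plates *)

Section TubeVolumes.
Variable R : realType.
Implicit Types x y z u v w n p a : R3 R.
Implicit Types A B : set (R3 R).

Lemma tube_cross (d : R) a v x : enorm v = 1 -> tube d a v x ->
  enorm (cross3 (x - a) v) <= d.
Proof.
move=> v1 [_ [t _ ->] xt].
have -> : cross3 (x - a) v = cross3 (x - (a + t *: v)) v.
  by rewrite !crossBl crossDl crossZl crossxx scaler0 addr0.
by apply: le_trans (enorm_cross _ _) _; rewrite v1 mulr1 ltW.
Qed.

Lemma tube_crossB (d : R) a v x y : enorm v = 1 -> tube d a v x ->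
  tube d a v y -> enorm (cross3 (x - y) v) <= 2 * d.
Proof.
move=> v1 /(tube_cross v1) h1 /(tube_cross v1) h2.
have -> : cross3 (x - y) v = cross3 (x - a) v - cross3 (y - a) v.
  by rewrite -crossBl; congr (cross3 _ v); rewrite opprB addrA subrK.
by have := enormB (cross3 (x - a) v) (cross3 (y - a) v); lra.
Qed.

Lemma tube_diff (d : R) a v x y : tube d a v x -> tube d a v y ->
  exists2 s : R, `|s| <= 1 & enorm (x - y - s *: v) <= 2 * d.
Proof.
move=> [_ [t t01 ->] xt] [_ [s s01 ->] ys]; exists (t - s).
  by move/andP: t01 => []; move/andP: s01 => [] *; rewrite ler_norml; apply/andP; split; lra.
have -> : x - y - (t - s) *: v = (x - (a + t *: v)) - (y - (a + s *: v)).
  by rewrite scalerBl !opprB !opprD !addrA; congr (_, _, _); rewrite /=; ring.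
by apply: le_trans (enormB _ _) _; lra.
Qed.

(** Any point of [A] serves as the centre of the box, so that only differences of points of [A] need
    to be estimated. *)
Lemma vol_diam_box v n A (r1 r2 r3 : R) : enorm v = 1 -> enorm n = 1 ->
  dot3 v n = 0 -> 0 < r1 -> 0 < r2 -> 0 < r3 ->
  (forall x y, A x -> A y -> [/\ `|dot3 (x - y) v| <= r1,
      `|dot3 (x - y) n| <= r2 & `|dot3 (x - y) (cross3 v n)| <= r3]) ->
  (vol A <= (12 ^+ 3 * (r1 * r2 * r3))%:E)%E.
Proof.
move=> v1 n1 vn r10 r20 r30 hA; have [[y Ay]|A0] := pselect (A !=set0).
  by apply: (@vol_box R v n y) => // x Ax; exact: hA.
have -> : A = set0 by apply/seteqP; split => x // Ax; case: A0; exists x.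
rewrite outer_measure0 lee_fin; apply: mulr_ge0; first exact: exprn_ge0.
by apply: ltW; rewrite !mulr_gt0.
Qed.

Lemma vol_thin_tube (d l : R) a v A : 0 < d -> 0 < l -> enorm v = 1 ->
  A `<=` tube d a v -> (forall x y, A x -> A y -> `|dot3 (x - y) v| <= l) ->
  (vol A <= ((4 * 12 ^+ 3) * (d ^+ 2 * l))%:E)%E.
Proof.
move=> d0 l0 v1 At Al; have [n n1 vn] := orth_unit v1.
have d20 : 0 < 2 * d by rewrite mulr_gt0.
have := @vol_diam_box v n A l (2 * d) (2 * d) v1 n1 vn l0 d20 d20.
have -> : 12 ^+ 3 * (l * (2 * d) * (2 * d)) = (4 * 12 ^+ 3) * (d ^+ 2 * l) by ring.
apply=> x y Ax Ay; have h := tube_crossB v1 (At _ Ax) (At _ Ay).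
split; [exact: Al| |]; apply: le_trans h; apply: dot_le_cross => //.
  exact: enorm_cross_orth.
exact: dot_crossl.
Qed.

Lemma vol_tube_le (d : R) a v : 0 < d -> d <= 1 -> enorm v = 1 ->
  (vol (tube d a v) <= (12 ^+ 4 * d ^+ 2)%:E)%E.
Proof.
move=> d0 d1 v1; have -> : 12 ^+ 4 * d ^+ 2 = (4 * 12 ^+ 3) * (d ^+ 2 * 3) by ring.
apply: (@vol_thin_tube d 3 a v) => // x y xT yT; have [s s1 hs] := tube_diff xT yT.
apply: le_trans (cauchy_schwarz _ _) _; rewrite v1 mulr1.
rewrite -[x - y](subrK (s *: v)); apply: le_trans (enormD _ _) _.
by rewrite enormZ v1; lra.
Qed.

(** The difference of two common points is within [2 * d] of both directions, so by
    [dot_cross_bound] it extends at most [4 * d / s] along [v]. *)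
Lemma vol_tubeI (d s : R) a v a' v' : 0 < d -> 0 < s -> enorm v = 1 ->
  enorm v' = 1 -> s <= enorm (cross3 v v') ->
  (vol (tube d a v `&` tube d a' v') <= ((16 * 12 ^+ 3) * (d ^+ 3 / s))%:E)%E.
Proof.
move=> d0 s0 v1 v'1 sv.
have -> : (16 * 12 ^+ 3) * (d ^+ 3 / s) = (4 * 12 ^+ 3) * (d ^+ 2 * (4 * d / s)) by ring.
apply: (@vol_thin_tube d _ a v) => //; first by rewrite divr_gt0 ?mulr_gt0.
move=> x y [xT xT'] [yT yT']; rewrite ler_pdivlMr //.
have := dot_cross_bound (x - y) v1 v'1.
have := tube_crossB v1 xT yT; have := tube_crossB v'1 xT' yT'.
have := ler_wpM2l (normr_ge0 (dot3 (x - y) v)) sv; lra.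
Qed.

Definition cylinder a v (r : R) : set (R3 R) :=
  [set x | enorm (cross3 (x - a) v) <= r].

(** The same argument as for two tubes, with the distance [r] to the second axis in place of [d]. *)
Lemma vol_tube_near (d s r : R) a v a' v' : 0 < d -> 0 < s -> 0 < r ->
  enorm v = 1 -> enorm v' = 1 -> s <= enorm (cross3 v v') ->
  (vol (tube d a v `&` cylinder a' v' r) <=
    (24 ^+ 3 * (d ^+ 2 * ((r + d) / s)))%:E)%E.
Proof.
move=> d0 s0 r0 v1 v'1 sv.
have -> : 24 ^+ 3 * (d ^+ 2 * ((r + d) / s)) = (4 * 12 ^+ 3) * (d ^+ 2 * (2 * (r + d) / s)) by ring.
apply: (@vol_thin_tube d _ a v) => //.
  by rewrite divr_gt0 ?mulr_gt0 ?addr_gt0.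
move=> x y [xT xr] [yT yr]; rewrite /cylinder /= in xr yr.
rewrite ler_pdivlMr //.
have := dot_cross_bound (x - y) v1 v'1.
have -> : cross3 (x - y) v' = cross3 (x - a') v' - cross3 (y - a') v'.
  by rewrite -crossBl; congr (cross3 _ _); rewrite opprB addrA subrK.
have := enormB (cross3 (x - a') v') (cross3 (y - a') v').
have := tube_crossB v1 xT yT.
have := ler_wpM2l (normr_ge0 (dot3 (x - y) v)) sv; lra.
Qed.

Lemma vol_slab n (c r : R) : n != 0 -> 0 < r ->
  (vol (@unit_ball R `&` thicken r (plane n c)) <= (24 ^+ 3 * r)%:E)%E.
Proof.
move=> n0 r0; have e0 : enorm n != 0.
  apply: contraNneq n0 => e0; have [] := enorm_coord n; rewrite e0 !normr_le0.
  by case: n {e0} => -[n1 n2] n3 /= /eqP -> /eqP -> /eqP ->.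
have ep : 0 < enorm n by rewrite lt_def e0 enorm_ge0.
pose v := (enorm n)^-1 *: n.
have v1 : enorm v = 1 by rewrite enormZ ger0_norm ?invr_ge0 ?enorm_ge0 // mulVf.
have [m m1 vm] := orth_unit v1.
have r20 : 0 < 2 * r by rewrite mulr_gt0.
have := @vol_diam_box v m (@unit_ball R `&` thicken r (plane n c)) (2 * r) 2 2 v1 m1 vm r20.
have -> : 12 ^+ 3 * (2 * r * 2 * 2) = 24 ^+ 3 * r by ring.
apply=> // x y [xB xP] [yB yP].
have B2 u : enorm u = 1 -> `|dot3 (x - y) u| <= 2.
  move=> u1; apply: le_trans (cauchy_schwarz _ _) _; rewrite u1 mulr1.
  by move: (enormB x y) xB yB; rewrite /unit_ball /=; lra.
have P z : thicken r (plane n c) z -> `|dot3 z v - c / enorm n| <= r.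
  case=> q /= nq zq; have -> : dot3 z v - c / enorm n = dot3 (z - q) v.
    by rewrite dotBl; congr (_ - _); rewrite dotZr dotC nq mulrC.
  by apply: le_trans (cauchy_schwarz _ _) _; rewrite v1 mulr1 ltW.
split; [|exact: B2|by apply: B2; exact: enorm_cross_orth].
move: (P _ xP) (P _ yP); rewrite !ler_norml dotBl => /andP[? ?] /andP[? ?].
by apply/andP; split; lra.
Qed.

(** For [v] orthogonal to [n], a set inside a box of sides about [1], [r1] and [r2]. The plane and
    the line have separate base points because in the hairbrush one is located by a crossing point
    and the other by the axis of a tube. *)
Definition plate p n (r1 : R) a v (r2 : R) : set (R3 R) :=
  @unit_ball R `&` [set x | `|dot3 (x - p) n| <= r1 /\ enorm (cross3 (x - a) v) <= r2].

Lemma vol_plate p n (r1 : R) a v (r2 : R) : 0 < r1 -> 0 < r2 -> enorm v = 1 ->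
  enorm n = 1 -> dot3 v n = 0 ->
  (vol (plate p n r1 a v r2) <= (24 ^+ 3 * (r1 * r2))%:E)%E.
Proof.
move=> r10 r20 v1 n1 vn.
have -> : 24 ^+ 3 * (r1 * r2) = 12 ^+ 3 * (2 * (2 * r1) * (2 * r2)) by ring.
apply: (@vol_diam_box v n) => //; rewrite ?mulr_gt0 // => x y.
move=> [xB [/= xn xv]] [yB [/= yn yv]]; split.
- apply: le_trans (cauchy_schwarz _ _) _; rewrite v1 mulr1.
  by move: (enormB x y) xB yB; rewrite /unit_ball /=; lra.
- have -> : dot3 (x - y) n = dot3 (x - p) n - dot3 (y - p) n by rewrite !dotBl; ring.
  by move: xn yn; rewrite !ler_norml => /andP[? ?] /andP[? ?]; apply/andP; split; lra.
have m1 := enorm_cross_orth v1 n1 vn.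
apply: le_trans (dot_le_cross (x - y) v1 m1 (dot_crossl v n)) _.
have -> : cross3 (x - y) v = cross3 (x - a) v - cross3 (y - a) v.
  by rewrite -crossBl; congr (cross3 _ _); rewrite opprB addrA subrK.
by have := enormB (cross3 (x - a) v) (cross3 (y - a) v); lra.
Qed.

(** Each of the three conditions bounds the norm of an affine function of the point. *)
Lemma convex_plate p n (r1 : R) a v (r2 : R) : convex_set (plate p n r1 a v r2).
Proof.
move=> x y t; rewrite !inE => -[/= xB [/= xn xv]] [/= yB [/= yn yv]].
have -> : conv t x y = t%:num *: (x : R3 R) + (1 - t%:num) *: (y : R3 R) by [].
set s := t%:num; have [s0 s1] : 0 <= s /\ 0 <= 1 - s.
  by rewrite subr_ge0 /s; split.
have comb u w (r : R) : enorm u <= r -> enorm w <= r ->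
    enorm (s *: u + (1 - s) *: w) <= r.
  move=> ur wr; apply: le_trans (enormD _ _) _; rewrite !enormZ !ger0_norm //.
  have := ler_wpM2l s0 ur; have := ler_wpM2l s1 wr; lra.
have E q : s *: x + (1 - s) *: y - q = s *: (x - q) + (1 - s) *: (y - q).
  by congr (_, _, _); rewrite /= /GRing.scale /=; ring.
split; first exact: comb.
split; last by rewrite /= E crossDl !crossZl; exact: comb.
rewrite /= E dotDl !dotZl; apply: le_trans (ler_normD _ _) _.
rewrite !normrM !(ger0_norm s0) !(ger0_norm s1).
have := ler_wpM2l s0 xn; have := ler_wpM2l s1 yn; lra.
Qed.

(** Cubes of side [d / 2], centred at distance [d] from one another along the axis, are disjoint and
    lie in the tube; there are more than [d^-1] of them. *)
Lemma vol_tube_ge (d : R) a v : 0 < d -> enorm v = 1 ->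
  ((d ^+ 2 / 8)%:E <= vol (tube d a v))%E.
Proof.
move=> d0 v1; pose N := (Num.truncn d^-1).+1.
have [N1 N2] : (N.-1%:R <= d^-1 /\ d^-1 < N%:R :> R).
  by apply/andP; apply: truncn_itv; rewrite invr_ge0 ltW.
pose F (k : 'I_N) := cube (a + (k%:R * d) *: v) (d / 4).
have d4 : 0 <= d / 4 by rewrite divr_ge0 // ltW.
(* If two of the cubes met, every coordinate of [v] would have square at most [1 / 4], and the three
   squares could not add up to [1]. *)
have dF i j x : F i x -> F j x -> i = j.
  move=> [a1 a2 a3] [b1 b2 b3]; apply: contraPeq (enorm_eq1 v1) => ij.
  have ij1 : 1 <= `|i%:R - j%:R| :> R.
    wlog ji : i j ij {a1 a2 a3 b1 b2 b3} / (j < i)%N.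
      move=> h; case: (ltngtP j i) => [|ji|/val_inj ji]; first exact: h.
        by rewrite distrC h // eq_sym.
      by rewrite ji eqxx in ij.
    by rewrite -natrB 1?ltnW // ger0_norm ?ler0n // ler1n subn_gt0.
  have C (c y s : R) : `|y - (c + i%:R * d * s)| <= d / 4 ->
      `|y - (c + j%:R * d * s)| <= d / 4 -> s ^+ 2 <= 1 / 4.
    move=> h1 h2; have : `|i%:R - j%:R| * d * `|s| <= d / 2.
      rewrite -[X in _ * X * _](gtr0_norm d0) -!normrM.
      move: h1 h2; rewrite !ler_norml => /andP[? ?] /andP[? ?]; apply/andP; split; lra.
    move=> h3; have : d * `|s| <= d * (1 / 2).
      have := ler_wpM2r (normr_ge0 s) (ler_wpM2r (ltW d0) ij1); lra.
    rewrite ler_pM2l // => h; rewrite -[s ^+ 2]real_normK ?num_real //.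
    have := normr_ge0 s; nra.
  have := C _ _ _ a1 b1; have := C _ _ _ a2 b2; have := C _ _ _ a3 b3.
  rewrite /dot3 -!expr2; lra.
have mF i : lebesgue_measurable3 (F i) by exact: cube_cara.
have FT : \big[setU/set0]_(i <- index_enum 'I_N | predT i) F i `<=` tube d a v.
  rewrite -bigcup_seq_cond => x [k _ [x1 x2 x3]].
  exists (a + (k%:R * d) *: v).
    exists (k%:R * d) => //; rewrite mulr_ge0 ?ler0n ?(ltW d0) //=.
    rewrite -ler_pdivlMr // mul1r; apply: le_trans N1; rewrite ler_nat.
    by rewrite -ltnS prednK.
  apply: (@le_lt_trans _ _ (d / 2)); last lra.
  rewrite enormP ?divr_ge0 ?(ltW d0) // /dot3 -!expr2.
  have s t : `|t| <= d / 4 -> t ^+ 2 <= d ^+ 2 / 16.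
    move=> h; rewrite -[t ^+ 2]real_normK ?num_real //.
    have := normr_ge0 t; nra.
  have := s _ x1; have := s _ x2; have := s _ x3; have := sqr_ge0 d => /=; nra.
apply: le_trans (le_vol FT); rewrite vol_bigU ?index_enum_uniq //.
under eq_bigr => i _ do rewrite vol_cube //.
rewrite sumEFin lee_fin big_const iter_addr addr0 -[X in _ <= X]mulr_natl card_ord.
have -> : d ^+ 2 / 8 = d^-1 * (2 * (d / 4)) ^+ 3 by field; exact: lt0r_neq0.
by apply: ler_wpM2r; [rewrite exprn_ge0 // mulr_ge0|exact: ltW].
Qed.

(** The tube extends by [3 / 4 * d] beyond both ends of its axis, so its diameter is at least
    [1 + 3 / 2 * d], while that of the ball is [2]. A factor below [1] is taken because the
    neighbourhood is open. *)
Lemma tube_in_ball_le (d : R) a v : 0 < d -> enorm v = 1 ->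
  tube d a v `<=` @unit_ball R -> d <= 1.
Proof.
move=> d0 v1 h; have D0 : enorm (- (3 / 4 * d) *: v) < d.
  by rewrite enormZ v1 normrN ger0_norm ?mulr1; lra.
have D1 : enorm ((3 / 4 * d) *: v) < d by rewrite enormZ v1 ger0_norm ?mulr1; lra.
have h0 : unit_ball (a + - (3 / 4 * d) *: v).
  apply: h; exists a; last by rewrite addrAC subrr add0r.
  by exists 0; rewrite ?lexx ?ler01 // scale0r addr0.
have h1 : unit_ball (a + v + (3 / 4 * d) *: v).
  apply: h; exists (a + v); last by rewrite addrAC subrr add0r.
  by exists 1; rewrite ?lexx ?ler01 // scale1r.
move: h0 h1; rewrite /unit_ball /= => h0 h1.
have := enormB (a + v + (3 / 4 * d) *: v) (a + - (3 / 4 * d) *: v).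
have -> : a + v + (3 / 4 * d) *: v - (a + - (3 / 4 * d) *: v) = (1 + 3 / 2 * d) *: v.
  by congr (_, _, _); rewrite /= /GRing.scale /=; field.
rewrite enormZ v1 ger0_norm ?mulr1; lra.
Qed.
End TubeVolumes.

(** * Tubes that cross other tubes *)

Section Geometry.
Variable R : realType.
Implicit Types x y z u v w n p a : R3 R.
Implicit Types A B : set (R3 R).

Lemma cylinder_cara a v (r : R) : 0 <= r -> lebesgue_measurable3 (cylinder a v r).
Proof.
move=> r0.
have := @caratheodory_measurable_mu_ext _ R (R3meas R) (@borel_lebesgue3 R)
  (cylinder a v r).
apply; pose f (x : R3meas R) : measurableTypeR R :=
  dot3 (cross3 ((x : R3 R) - a) v) (cross3 ((x : R3 R) - a) v).
have mf : measurable_fun setT f.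
  have m1 : measurable_fun setT (fun x : R3meas R => x.1.1 : measurableTypeR R).
    exact: measurableT_comp measurable_fst.
  have m2 : measurable_fun setT (fun x : R3meas R => x.1.2 : measurableTypeR R).
    exact: measurableT_comp measurable_fst.
  have m3 : measurable_fun setT (fun x : R3meas R => x.2 : measurableTypeR R).
    exact: measurable_snd.
  have mB (g h : R3meas R -> R) : measurable_fun setT g -> measurable_fun setT h ->
      measurable_fun setT (fun x => g x - h x) by exact: measurable_funB.
  have mD (g h : R3meas R -> R) : measurable_fun setT g -> measurable_fun setT h ->
      measurable_fun setT (fun x => g x + h x) by exact: measurable_funD.
  have mM (g h : R3meas R -> R) : measurable_fun setT g -> measurable_fun setT h ->
      measurable_fun setT (fun x => g x * h x) by exact: measurable_funM.
  have mc (c : R) : measurable_fun setT ((fun=> c) : R3meas R -> R).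
    exact: measurable_cst.
  rewrite /f /dot3 /=.
  by apply (mD); [apply (mD)|]; apply (mM); apply (mB); apply (mM) => //; apply (mB).
have -> : cylinder a v r = setT `&` f @^-1` `]-oo, r ^+ 2].
  rewrite setTI; apply/seteqP; split => x; rewrite /cylinder /= enormP // in_itv /=.
apply: mf => //.
Qed.

(** Starting from the common point [z], one moves along [v'] by at most unit length; this changes
    the distance to the axis of the first tube by at most the angle, up to errors of order [d]. *)
Lemma tube_meets (d : R) a v a' v' x z : enorm v = 1 ->
  tube d a v z -> tube d a' v' z -> tube d a' v' x ->
  enorm (cross3 (x - a) v) <= 3 * d + enorm (cross3 v' v).
Proof.
move=> v1 zT zT' xT'; have [s s1 hs] := tube_diff xT' zT'.
have -> : cross3 (x - a) v =
    cross3 (z - a) v + s *: cross3 v' v + cross3 (x - z - s *: v') v.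
  rewrite -crossZl -!crossDl; congr (cross3 _ v).
  by congr (_, _, _); rewrite /= /GRing.scale /=; ring.
have := enormD (cross3 (z - a) v + s *: cross3 v' v) (cross3 (x - z - s *: v') v).
have := enormD (cross3 (z - a) v) (s *: cross3 v' v).
have := tube_cross v1 zT; have := enorm_cross (x - z - s *: v') v; rewrite v1 mulr1.
rewrite enormZ; have := ler_wpM2r (enorm_ge0 (cross3 v' v)) s1; lra.
Qed.

Lemma tube_dot (d : R) a v n x z : enorm n = 1 -> dot3 v n = 0 ->
  tube d a v x -> tube d a v z -> `|dot3 (x - z) n| <= 2 * d.
Proof.
move=> n1 vn xT zT; have [s _ hs] := tube_diff xT zT.
have -> : dot3 (x - z) n = dot3 (x - z - s *: v) n by rewrite [RHS]dotBl dotZl vn mulr0 subr0.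
by apply: le_trans (cauchy_schwarz _ _) _; rewrite n1 mulr1.
Qed.

(* If [T'] crosses both [T] and [T0], the second crossing being far from the
   first, then [T'] is almost parallel to the plane spanned by [T] and [T0]. *)
Lemma tube_near_plane (d th rho : R) n a v a0 v0 a' v' p0 p q x :
  0 < d -> 0 < th -> 6 * d <= rho ->
  enorm n = 1 -> dot3 v n = 0 -> dot3 v0 n = 0 -> enorm v0 = 1 -> enorm v' = 1 ->
  tube d a v p0 -> tube d a0 v0 p0 -> tube d a0 v0 p -> tube d a' v' p ->
  tube d a v q -> tube d a' v' q -> tube d a' v' x ->
  rho <= enorm (cross3 (q - a0) v0) -> enorm (cross3 v' v0) <= th ->
  `|dot3 (x - p0) n| <= 4 * d + 12 * (d * (th / rho)).
Proof.
move=> d0 th0 drho n1 vn v0n v01 v'1 p0T p0T0 pT0 pT' qT qT' xT' qfar ang.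
have r0 : 0 < rho by lra.
have [s s1 hs] := tube_diff qT' pT'.
(* Along [v'] the distance to the axis of [T0] grows at rate at most [th]. It goes from at most [d]
   at [p] to at least [rho] at [q], which forces a long chord; the errors [3 * d] are at most
   [rho / 2]. *)
have hsth : rho / 2 <= `|s| * th.
  have E : cross3 (q - a0) v0 =
      cross3 (p - a0) v0 + s *: cross3 v' v0 + cross3 (q - p - s *: v') v0.
    rewrite -crossZl -!crossDl; congr (cross3 _ v0).
    by congr (_, _, _); rewrite /= /GRing.scale /=; ring.
  move: qfar; rewrite E.
  have := enormD (cross3 (p - a0) v0 + s *: cross3 v' v0) (cross3 (q - p - s *: v') v0).
  have := enormD (cross3 (p - a0) v0) (s *: cross3 v' v0).
  have := tube_cross v01 pT0; have := enorm_cross (q - p - s *: v') v0; rewrite v01 mulr1.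
  rewrite enormZ; have := ler_wpM2l (normr_ge0 s) ang; lra.
have hp := tube_dot n1 v0n pT0 p0T0; have hq := tube_dot n1 vn qT p0T.
(* Both ends of the chord lie close to the plane. *)
have sn : `|s| * `|dot3 v' n| <= 6 * d.
  rewrite -normrM -dotZl.
  have -> : s *: v' = (q - p0) - (p - p0) - (q - p - s *: v').
    by congr (_, _, _); rewrite /= /GRing.scale /=; ring.
  rewrite 2!dotBl; apply: le_trans (ler_normB _ _) _.
  have := ler_normB (dot3 (q - p0) n) (dot3 (p - p0) n).
  have := cauchy_schwarz (q - p - s *: v') n; rewrite n1 mulr1; lra.
have vn' : `|dot3 v' n| <= 12 * (d * (th / rho)).
  have -> : 12 * (d * (th / rho)) = (12 * d * th) / rho by ring.
  rewrite ler_pdivlMr // mulrC.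
  have := ler_wpM2r (normr_ge0 (dot3 v' n)) hsth.
  have := ler_wpM2r (ltW th0) sn; lra.
have [t t1 ht] := tube_diff xT' qT'.
have -> : dot3 (x - p0) n = dot3 (q - p0) n + t * dot3 v' n + dot3 (x - q - t *: v') n.
  by rewrite -dotZl -!dotDl; congr (dot3 _ n); congr (_, _, _); rewrite /= /GRing.scale /=; ring.
have := ler_normD (dot3 (q - p0) n + t * dot3 v' n) (dot3 (x - q - t *: v') n).
have := ler_normD (dot3 (q - p0) n) (t * dot3 v' n).
have := cauchy_schwarz (x - q - t *: v') n; rewrite n1 mulr1 normrM.
have := ler_wpM2r (normr_ge0 (dot3 v' n)) t1; lra.
Qed.
End Geometry.

(** * Hairbrushes *)

Section TubeFamily.
Variables (R : realType) (I : finType) (a v : I -> R3 R) (d K : R) (L : nat).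
Variable bin : I -> I -> 'I_L.
Local Notation T i := (tube d (a i) (v i)).
Local Notation ang i j := (enorm (cross3 (v i) (v j))).
Local Notation scale k := (2 ^+ nat_of_ord k * d).
Hypotheses (d0 : 0 < d) (d1 : d <= 1) (v1 : forall i, enorm (v i) = 1).
Hypothesis Tball : forall i, T i `<=` @unit_ball R.
Hypothesis bin_le : forall i j, ang i j <= scale (bin i j).
(** The lowest scale also collects all angles below [d], for which no lower bound is available. *)
Hypothesis bin_ge :
  forall i j, bin i j = 0%N :> nat \/ scale (bin i j) <= 2 * ang i j.
(** The Katz-Tao condition for plates, with the absolute constants absorbed into [K]. *)
Hypothesis few_in_plate : forall p n (r1 : R) a' v' (r2 : R) (H : {set I}),
  0 < r1 -> 0 < r2 -> enorm v' = 1 -> enorm n = 1 -> dot3 v' n = 0 ->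
  (forall i, i \in H -> T i `<=` plate p n r1 a' v' r2) ->
  #|H|%:R <= K * (r1 * r2 / d ^+ 2).

Lemma scale_ge k : d <= scale (k : 'I_L).
Proof. by rewrite ler_peMl ?(ltW d0) // exprn_ege1 // ler1n. Qed.

Lemma scale_gt0 k : 0 < scale (k : 'I_L).
Proof. exact: lt_le_trans (scale_ge _). Qed.

Lemma fineK_ball A : A `<=` @unit_ball R -> (fine (vol A))%:E = vol A.
Proof. by move/fin_vol/fineK. Qed.

Lemma fine_vol_le A (c : R) : A `<=` @unit_ball R ->
  (fine (vol A) <= c) = (vol A <= c%:E)%E.
Proof. by move=> /fineK_ball {2}<-; rewrite lee_fin. Qed.

(** At the lowest scale the intersection is bounded by a whole tube, of volume about [d ^+ 2]; at
    the others [vol_tubeI] applies. *)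
Lemma vol_tubeI_bin i j :
  (vol (T i `&` T j) <= (32 * 12 ^+ 3 * (d ^+ 3 / scale (bin i j)))%:E)%E.
Proof.
have s0 := scale_gt0 (bin i j).
case: (bin_ge i j) => h.
  apply: le_trans (le_vol (@subIsetl _ _ _)) _.
  apply: le_trans (vol_tube_le _ d0 d1 (v1 i)) _; rewrite lee_fin h expr0 mul1r.
  have -> : d ^+ 3 / d = d ^+ 2 by field; exact: lt0r_neq0.
  have := sqr_ge0 d; lra.
have s20 : 0 < scale (bin i j) / 2 by rewrite divr_gt0.
apply: le_trans (vol_tubeI _ _ d0 s20 (v1 i) (v1 j) _) _; first lra.
move: s0; set s := scale _ => s0.
rewrite lee_fin le_eqVlt; apply/orP; left; apply/eqP; field; exact: lt0r_neq0.
Qed.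

Lemma bound_ge0 (o : I) : 0 <= K.
Proof.
have [n n1 vn] := orth_unit (v1 o).
have := few_in_plate (p := 0) (a' := 0) (H := finset.set0) d0 d0 (v1 o) n1 vn.
rewrite cards0 -expr2 divff ?mulr1; last by rewrite expf_neq0 // lt0r_neq0.
by apply=> i; rewrite inE.
Qed.

(** At such small angles the whole hairbrush lies within distance about [B * (d / tau)] of one axis,
    hence in one thin plate, which contains few tubes. The shading of a single tube is then a
    sufficient lower bound for [V]. *)
Lemma hairbrush_small_angle (B tau V : R) (o : I) (k : 'I_L) (H : {set I})
    (Z : I -> set (R3 R)) :
  1 <= B -> 0 < tau -> tau <= 1 -> scale k <= B * (d / tau) ->
  (forall i, i \in H -> (T i `&` T o) !=set0 /\ bin i o = k) ->
  (forall i, i \in H -> Z i `<=` T i /\ tau * d ^+ 2 <= fine (vol (Z i))) ->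
  (vol (\bigcup_(i in [set i | i \in H]) Z i) <= V%:E)%E ->
  #|H|%:R * (d ^+ 2 * tau ^+ 3) <= 16 * (B ^+ 2 * (K * V)).
Proof.
move=> B1 t0 t1 kB hH hZ hV; have td := divr_gt0 d0 t0.
have [->|/finset.set0Pn[i0 i0H]] := eqVneq H finset.set0.
  rewrite cards0 mul0r.
  have V0 : 0 <= V by rewrite -lee_fin (le_trans (vol_ge0 _) hV).
  apply: mulr_ge0; first exact: ler0n.
  by apply: mulr_ge0; [exact: sqr_ge0|apply: mulr_ge0; first exact: bound_ge0 o].
have hV0 : tau * d ^+ 2 <= V.
  apply: le_trans (hZ _ i0H).2 _; rewrite fine_vol_le.
    by apply: le_trans hV; apply: le_vol => x xZ; exists i0.
  exact: (subset_trans (hZ _ i0H).1 (@Tball i0)).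
have dd : d <= d / tau by rewrite ler_pdivlMr // ler_piMr // ltW.
set r := 4 * B * (d / tau).
have r0 : 0 < r.
  by apply: mulr_gt0 => //; apply: mulr_gt0 => //; exact: lt_le_trans B1.
have [n n1 vn] := orth_unit (v1 o).
have := few_in_plate (p := a o) (a' := a o) (H := H) r0 r0 (v1 o) n1 vn.
have E : r * r / d ^+ 2 * tau ^+ 2 = 16 * B ^+ 2.
  by rewrite /r; field; rewrite !lt0r_neq0.
move=> h; have {h} hc : #|H|%:R <= K * (r * r / d ^+ 2).
  apply: h => i iH x xT; split; first exact: Tball xT.
  have cyl : enorm (cross3 (x - a o) (v o)) <= r.
    have [[z [zi zo]] bk] := hH _ iH.
    have := tube_meets (v1 o) zo zi xT; have := bin_le i o; rewrite bk.
    have : d / tau <= B * (d / tau) by rewrite ler_peMl // ltW.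
    rewrite /r; lra.
  by split=> //; apply: le_trans cyl; apply: dot_le_cross.
have c0 : 0 <= K * (16 * B ^+ 2).
  rewrite -E mulrA mulr_ge0 ?sqr_ge0 //; apply: le_trans hc; exact: ler0n.
have t30 : 0 <= d ^+ 2 * tau ^+ 3.
  by apply: mulr_ge0; apply: exprn_ge0; exact: ltW.
apply: le_trans (ler_wpM2r t30 hc) _.
have -> : K * (r * r / d ^+ 2) * (d ^+ 2 * tau ^+ 3) =
    K * (r * r / d ^+ 2 * tau ^+ 2) * (tau * d ^+ 2) by ring.
rewrite E; apply: le_trans (ler_wpM2l c0 hV0) _; lra.
Qed.

(** By [tube_near_plane] these tubes are close to the plane spanned by [T i] and [T o], and by
    [tube_meets] they are within [4 * scale m] of the axis of [T i]. So they share a plate. *)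
Lemma few_crossing (B tau : R) (o i : I) (k m : 'I_L) (H : {set I}) :
  1 <= B -> 0 < tau -> tau <= 1 -> 6 * B * (d / tau) <= scale k ->
  bin i o = k -> (T i `&` T o) !=set0 -> 0 < ang i o ->
  (forall j, j \in H -> [/\ (T j `&` T o) !=set0, bin j o = k, bin i j = m &
     exists2 q, (T i `&` T j) q & tau * scale k / B <= enorm (cross3 (q - a o) (v o))]) ->
  #|H|%:R <= 64 * B * (K * (scale m / (tau * d))).
Proof.
move=> B1 t0 t1 kB bk [p0 [p0i p0o]] ang0 hH.
have B0 : 0 < B by exact: lt_le_trans B1.
have td := divr_gt0 d0 t0; have sk := scale_gt0 k; have sm := scale_gt0 m.
have dd : d <= d / tau by rewrite ler_pdivlMr // ler_piMr // ltW.
have ddB : d / tau <= B * (d / tau) by rewrite ler_peMl // ltW.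
set w := cross3 (v i) (v o) in ang0; pose n := (enorm w)^-1 *: w.
have n1 : enorm n = 1.
  by rewrite enormZ ger0_norm ?invr_ge0 ?enorm_ge0 // mulVf // lt0r_neq0.
have vin : dot3 (v i) n = 0 by rewrite dotZr dot_crossl mulr0.
have von : dot3 (v o) n = 0 by rewrite dotZr dot_crossr mulr0.
(* With angle [scale k] and distance [rho], the ratio in [tube_near_plane] is [B / tau]; hence the
   plate has thickness of order [B * (d / tau)]. *)
set rho := tau * scale k / B in hH.
have rho6 : 6 * d <= rho.
  rewrite /rho ler_pdivlMr // mulrC.
  have := ler_wpM2l (ltW t0) kB; have -> : tau * (6 * B * (d / tau)) = B * (6 * d).
    by field; exact: lt0r_neq0.
  by [].
have r10 : 0 < 16 * B * (d / tau) by apply: mulr_gt0 => //; apply: mulr_gt0.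
have r20 : 0 < 4 * scale m by exact: mulr_gt0.
have -> : 64 * B * (K * (scale m / (tau * d))) =
    K * ((16 * B * (d / tau)) * (4 * scale m) / d ^+ 2).
  by move: (scale m) => s; field; rewrite !lt0r_neq0.
apply: (few_in_plate (p := p0) (n := n) (a' := a i) (v' := v i)) => //.
move=> j jH x xj; have [[p [pj po]] bj bij [q [qi qj] hq]] := hH _ jH.
split; first exact: Tball xj.
split; last first.
  apply: le_trans (tube_meets (v1 i) qi qj xj) _; rewrite crossC_norm.
  have := bin_le i j; rewrite bij; have := scale_ge m; lra.
have := tube_near_plane d0 sk rho6 n1 vin von (v1 o) (v1 j) p0i p0o po pj qi qj xj hq.
have -> : 12 * (d * (scale k / rho)) = 12 * (B * (d / tau)).
  by rewrite /rho; move: sk; move: (scale k) => s sk; field; rewrite !lt0r_neq0.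
have := bin_le j o; rewrite bj => h /(_ h); lra.
Qed.

(** An [L^2] argument. Remove from each shading its part near the axis of [T o], then apply
    [cauchy_schwarz_union] to the rest: away from that axis the pairwise intersections are
    controlled by [few_crossing], one scale at a time. *)
Lemma hairbrush_large_angle (B tau V : R) (o : I) (k : 'I_L) (H : {set I})
    (Z : I -> set (R3 R)) :
  8 * 24 ^+ 3 <= B -> 0 < tau -> tau <= 1 -> 6 * B * (d / tau) < scale k ->
  (forall i, i \in H -> (T i `&` T o) !=set0 /\ bin i o = k) ->
  (forall i, lebesgue_measurable3 (Z i)) ->
  (forall i, i \in H -> Z i `<=` T i /\ tau * d ^+ 2 <= fine (vol (Z i))) ->
  (vol (\bigcup_(i in [set i | i \in H]) Z i) <= V%:E)%E ->
  #|H|%:R * (d ^+ 2 * tau ^+ 3) <= 4 * 64 * 32 * 12 ^+ 3 * (B * (L%:R * (K * V))).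
Proof.
move=> hB t0 t1 kB hH mZ hZ hV.
have B1 : 1 <= B by apply: le_trans hB; lra.
have B0 : 0 < B by exact: lt_le_trans B1.
have td := divr_gt0 d0 t0; have sk := scale_gt0 k.
have dd : d <= d / tau by rewrite ler_pdivlMr // ler_piMr // ltW.
have ddB : d / tau <= B * (d / tau) by rewrite ler_peMl // ltW.
have angk i : i \in H -> scale k <= 2 * ang i o.
  move=> iH; have [_ bk] := hH _ iH; case: (bin_ge i o); rewrite bk // => k0.
  by move: kB; rewrite k0 expr0 mul1r; lra.
set rho := tau * scale k / B.
have rho0 : 0 < rho by rewrite divr_gt0 // mulr_gt0.
have rhoB : rho * B = tau * scale k by rewrite divfK // lt0r_neq0.
have dB : 6 * (d * B) < tau * scale k.
  have := ltr_pM2l t0 (6 * B * (d / tau)) (scale k); rewrite kB => /idP.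
  by have -> : tau * (6 * B * (d / tau)) = 6 * (d * B) by field; exact: lt0r_neq0.
pose F := cylinder (a o) (v o) rho.
have mF : lebesgue_measurable3 F by apply: cylinder_cara; exact: ltW.
pose Z' i := if i \in H then Z i `\` F else set0.
have mZ' i : lebesgue_measurable3 (Z' i).
  rewrite /Z'; case: ifP => _; last exact: caratheodory_measurable_set0.
  exact: (caratheodory_measurable_setD (mZ i) mF).
have Z'T i : Z' i `<=` T i.
  rewrite /Z'; case: ifP => [iH x [Zx _]|_ x []]; exact: (hZ _ iH).1.
have Z'ball i : Z' i `<=` @unit_ball R by exact: subset_trans (@Tball i).
have Z'V : (vol (\bigcup_i Z' i) <= V%:E)%E.
  apply: le_trans hV; apply: le_vol => x [i _]; rewrite /Z'.
  by case: ifP => // iH [Zx _]; exists i.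
(* [T i] leaves the axis of [T o] at angle at least [scale k / 2], so only a short piece of it lies
   in [F], with at most half of the shading. *)
have Z'ge i : i \in H -> tau * d ^+ 2 / 2 <= fine (vol (Z' i)).
  move=> iH; have [ZT] := hZ _ iH.
  have ball A : A `<=` Z i -> A `<=` @unit_ball R.
    by move=> AZ; apply: subset_trans AZ _; apply: subset_trans ZT (@Tball i).
  have -> : fine (vol (Z i)) = fine (vol (Z i `&` F)) + fine (vol (Z' i)).
    rewrite /Z' iH (mF (Z i)) -setDE fineD //; apply: fin_vol; apply: ball.
      exact: subIsetl.
    exact: subDsetl.
  suff : fine (vol (Z i `&` F)) <= tau * d ^+ 2 / 2 by lra.
  rewrite fine_vol_le; last by apply: ball; exact: subIsetl.
  have s0 : 0 < scale k / 2 by exact: divr_gt0.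
  have sa : scale k / 2 <= ang i o by have := angk _ iH; lra.
  have sub : Z i `&` F `<=` T i `&` F by move=> x [Zx Fx]; split=> //; exact: ZT.
  apply: le_trans (le_vol sub) _.
  apply: le_trans (vol_tube_near (a i) (a o) d0 s0 rho0 (v1 i) (v1 o) sa) _.
  rewrite lee_fin.
  have -> : tau * d ^+ 2 / 2 = d ^+ 2 * (tau / 2) by ring.
  rewrite mulrCA ler_pM2l ?exprn_gt0 // mulrA ler_pdivrMr //.
  have := ler_wpM2l (ltW rho0) hB; have := ler_wpM2l (ltW d0) hB; lra.
(* The number of crossing tubes is proportional to [scale m], the volume of one intersection
   inversely so; [D] is their product and bounds the contribution of every scale. *)
pose D := 64 * B * (32 * 12 ^+ 3) * (K * (d ^+ 2 / tau)).
have row i : \sum_j fine (vol (Z' i `&` Z' j)) <= (i \in H)%:R * (L%:R * D).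
  case iH: (i \in H); last first.
    rewrite mul0r big1 // => j _; rewrite {1}/Z' iH set0I; exact: (congr1 fine (outer_measure0 _)).
  rewrite mul1r (partition_big (bin i) predT) //=.
  have -> : L%:R * D = \sum_(m < L) D by rewrite sumr_const card_ord mulr_natl.
  apply: ler_sum => m _.
  (* A common point of the trimmed shadings lies outside [F], hence at the distance from the axis of
     [T o] that [few_crossing] requires. *)
  pose Hm := [set j in H | (bin i j == m) && `[< (Z' i `&` Z' j) !=set0 >]]%SET.
  have [meet bk] := hH _ iH; have a0 : 0 < ang i o by have := angk _ iH; lra.
  have Hc : #|Hm|%:R <= 64 * B * (K * (scale m / (tau * d))).
    apply: (few_crossing B1 t0 t1 (ltW kB) bk meet a0) => j.
    rewrite inE => /andP[jH /andP[/eqP bj /asboolP[q [qi qj]]]].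
    have [? ?] := hH _ jH; split=> //.
    exists q; first by split; exact: Z'T.
    move: qi; rewrite /Z' iH => -[_]; rewrite /F /cylinder /= => /negP.
    by rewrite -ltNge => /ltW.
  have c0 : 0 <= 32 * 12 ^+ 3 * (d ^+ 3 / scale m).
    apply: mulr_ge0; first by apply: mulr_ge0; [exact: ler0n|exact: exprn_ge0].
    by apply: divr_ge0; [apply: exprn_ge0|]; apply: ltW => //; exact: scale_gt0.
  apply: (@le_trans _ _ (\sum_(j in Hm) 32 * 12 ^+ 3 * (d ^+ 3 / scale m))).
    rewrite [X in _ <= X]big_mkcond [X in X <= _]big_mkcond /=; apply: ler_sum => j _.
    case: ifP => [/eqP bj|_]; last by case: ifP.
    case: ifPn => [_|].
      rewrite fine_vol_le; last by apply: subset_trans (Z'ball i); exact: subIsetl.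
      rewrite -bj; apply: le_trans _ (vol_tubeI_bin i j); apply: le_vol.
      by move=> x [/Z'T ? /Z'T].
    rewrite inE bj eqxx /= => hj; suff -> : Z' i `&` Z' j = set0.
      by rewrite (congr1 fine (outer_measure0 _)).
    apply/eqP/negPn/negP => /set0P ne; move: hj; rewrite asboolT // andbT.
    by case: ne => x [_]; rewrite /Z'; case: (j \in H).
  rewrite sumr_const -[X in X <= _]mulr_natl; apply: le_trans (ler_wpM2r c0 Hc) _.
  rewrite le_eqVlt /D; apply/orP; left; apply/eqP.
  by have := scale_gt0 m; move: (scale m) => s s0; field; rewrite !lt0r_neq0.
have CS := cauchy_schwarz_union mZ' Z'ball Z'V.
have [->|H0] := eqVneq H finset.set0.
  have V0 : 0 <= V by rewrite -lee_fin (le_trans (vol_ge0 _) hV).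
  rewrite cards0 mul0r; apply: mulr_ge0.
    by rewrite -!natrX -!natrM ler0n.
  by do 2![apply: mulr_ge0; rewrite ?ler0n ?(ltW B0) //]; rewrite mulr_ge0 ?(bound_ge0 o).
have V0 : 0 <= V by rewrite -lee_fin (le_trans (vol_ge0 _) hV).
set N : R := #|H|%:R.
have N0 : 0 < N by rewrite ltr0n card_gt0.
have S1 : N * (tau * d ^+ 2 / 2) <= \sum_i fine (vol (Z' i)).
  rewrite mulr_natl -sumr_const [X in _ <= X](bigID (mem H)) /= ler_wpDr //.
    by apply: sumr_ge0 => i _; rewrite fine_ge0 // vol_ge0.
  exact: ler_sum.
have S2 : \sum_i \sum_j fine (vol (Z' i `&` Z' j)) <= N * (L%:R * D).
  apply: le_trans (ler_sum _ (fun i _ => row i)) _.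
  rewrite -big_distrl /=; have -> : \sum_i (i \in H)%:R = N => //.
  rewrite /N -sum1_card natr_sum [RHS]big_mkcond /=.
  by apply: eq_bigr => i _; case: (i \in H).
have S3 : (N * (tau * d ^+ 2 / 2)) ^+ 2 <= V * (N * (L%:R * D)).
  have p0 : 0 <= N * (tau * d ^+ 2 / 2).
    by apply: ltW; rewrite mulr_gt0 // divr_gt0 // mulr_gt0 // exprn_gt0.
  apply: le_trans _ (ler_wpM2l V0 S2); apply: le_trans _ CS.
  by rewrite ler_sqr // nnegrE // (le_trans p0 S1).
have c0 : 0 < N * d ^+ 2 / (4 * tau).
  by rewrite divr_gt0 ?mulr_gt0 ?exprn_gt0.
rewrite -(ler_pM2l c0).
have -> : N * d ^+ 2 / (4 * tau) * (N * (d ^+ 2 * tau ^+ 3)) =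
    (N * (tau * d ^+ 2 / 2)) ^+ 2 by field; exact: lt0r_neq0.
apply: le_trans S3 _; rewrite le_eqVlt /D; apply/orP; left; apply/eqP.
by field; exact: lt0r_neq0.
Qed.

(* [8 * 24 ^+ 3] makes the part of a tube of the hairbrush that is close to the
   axis of [T o] at most half of its shading. *)
Definition hairbrush_const : R :=
  16 * (6 * (8 * 24 ^+ 3)) ^+ 2 + 4 * 64 * 32 * 12 ^+ 3 * (8 * 24 ^+ 3).

(** The two cases meet at angle [6 * B * (d / tau)], above which [rho] is at least the [6 * d]
    needed in [tube_near_plane]. *)
Lemma hairbrush (tau V : R) (o : I) (k : 'I_L) (H : {set I}) (Z : I -> set (R3 R)) :
  0 < tau -> tau <= 1 ->
  (forall i, i \in H -> (T i `&` T o) !=set0 /\ bin i o = k) ->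
  (forall i, lebesgue_measurable3 (Z i)) ->
  (forall i, i \in H -> Z i `<=` T i /\ tau * d ^+ 2 <= fine (vol (Z i))) ->
  (vol (\bigcup_(i in [set i | i \in H]) Z i) <= V%:E)%E ->
  #|H|%:R * (d ^+ 2 * tau ^+ 3) <= hairbrush_const * (L%:R * (K * V)).
Proof.
move=> t0 t1 hH mZ hZ hV; set B : R := 8 * 24 ^+ 3.
have B0 : 0 <= B by apply: mulr_ge0 => //; exact: exprn_ge0.
have L1 : 1 <= L%:R :> R by rewrite ler1n; apply: leq_ltn_trans (ltn_ord k).
have V0 : 0 <= V by rewrite -lee_fin (le_trans (vol_ge0 _) hV).
have KV : 0 <= K * V by rewrite mulr_ge0 // (bound_ge0 o).
have LKV : 0 <= L%:R * (K * V) by rewrite mulr_ge0.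
have KVL : K * V <= L%:R * (K * V) by rewrite ler_peMl.
rewrite /hairbrush_const -/B.
have B2 : 0 <= 16 * (6 * B) ^+ 2 by apply: mulr_ge0 => //; exact: sqr_ge0.
have c0 : 0 <= 4 * 64 * 32 * 12 ^+ 3 * B :> R.
  by apply: mulr_ge0 => //; rewrite -!natrX -!natrM ler0n.
case: (leP (scale k) (6 * B * (d / tau))) => hk.
  have B1 : 1 <= 6 * B by rewrite /B; lra.
  have := hairbrush_small_angle B1 t0 t1 hk hH hZ hV.
  have := ler_wpM2l B2 KVL; have := mulr_ge0 c0 LKV; lra.
have := hairbrush_large_angle (lexx _) t0 t1 hk hH mZ hZ hV; rewrite -/B.
have := mulr_ge0 B2 LKV; lra.
Qed.

End TubeFamily.

(** * Pigeonholing *)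

Lemma pigeonhole (R : realType) (A : finType) (P : pred A) (F : A -> R) (c : R) :
  0 < c -> c <= \sum_(x | P x) F x -> exists2 x, P x & c <= #|A|%:R * F x.
Proof.
move=> c0 cF; apply: contrapT => h.
have A0 : (0 < #|A|)%N.
  case: posnP => // A0; move: cF; rewrite big1 ?leNgt ?c0 // => x _.
  by move/card0_eq: A0 => /(_ x).
have {}h x : P x -> F x < c / #|A|%:R.
  move=> Px; rewrite ltr_pdivlMr ?ltr0n // ltNge; apply/negP => hx.
  by apply: h; exists x => //; rewrite mulrC.
have : exists x, P x.
  apply: contrapT => n; move: cF; rewrite big_pred0 ?leNgt ?c0 // => x.
  by apply/negP => Px; apply: n; exists x.
case=> x0 Px0; suff : \sum_(x | P x) F x < c by rewrite ltNge cF.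
apply: (@lt_le_trans _ _ (\sum_(x | P x) c / #|A|%:R)).
  rewrite (bigD1 x0) //= [X in _ < X](bigD1 x0) //=; apply: ltr_leD; first exact: h.
  by apply: ler_sum => x /andP[Px _]; apply: ltW; exact: h.
rewrite sumr_const -[X in X <= _]mulr_natr mulrAC ler_pdivrMr ?ltr0n //.
by rewrite ler_pM2l // ler_nat max_card.
Qed.

(* A point is encoded by the set [S] of the indices of the shadings that contain
   it, and the measure by the weights of the resulting atoms; [bin i j] is the
   dyadic scale of the angle between the tubes [i] and [j]. *)
Section Incidences.
Variables (R : realType) (I : finType) (L : nat) (bin : I -> I -> 'I_L).
Hypothesis bin_sym : forall i j, bin i j = bin j i.
Implicit Types (S : {set I}) (i j : I) (k : 'I_L).

Definition degree k i S : nat := #|[set j in S | bin i j == k]|.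

(** The threshold is a quarter of the average share of a scale, so that at a popular scale dropping
    the other indices on both sides of a pair costs at most half of the pairs. *)
Definition good k i S := (i \in S) && (#|S| <= 4 * L * degree k i S)%N.

Lemma sum_degree i S : (\sum_k degree k i S)%N = #|S|.
Proof.
rewrite -[RHS]sum1_card (partition_big (bin i) predT) //=; apply: eq_bigr => k _.
by rewrite /degree -sum1_card; apply: eq_bigl => j; rewrite inE.
Qed.

Definition popular k S := (#|S| ^ 2 <= L * \sum_(i in S) degree k i S)%N.

(** The degrees of one index over all [L] scales add up to [#|S|], so some scale carries at least
    the average number of pairs. *)
Lemma popular_exists S : S != finset.set0 -> exists k, popular k S.
Proof.
move=> /finset.set0Pn[i0 i0S]; apply: contrapT => h.
have {}h k : (L * \sum_(i in S) degree k i S < #|S| ^ 2)%N.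
  by rewrite ltnNge; apply/negP => hk; apply: h; exists k.
have : (\sum_(k < L) L * \sum_(i in S) degree k i S < \sum_(k < L) #|S| ^ 2)%N.
  have k0 := bin i0 i0.
  rewrite (bigD1 k0) //= [X in (_ < X)%N](bigD1 k0) //= -addSn leq_add //.
  by apply: leq_sum => k _; exact: ltnW.
rewrite -big_distrr /= exchange_big /= sum_nat_const card_ord.
under eq_bigr => i _ do rewrite sum_degree.
by rewrite sum_nat_const mulnn ltnn.
Qed.

Definition good_pairs k S : nat :=
  (\sum_(i in S | good k i S) #|[set j in S | (bin i j == k) && good k j S]|)%N.

(* Each point that is not good contributes few pairs, on either side. *)
Lemma many_good_pairs k S : popular k S -> (#|S| ^ 2 <= 2 * L * good_pairs k S)%N.
Proof.
move=> pop; have dc :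
    (\sum_(i in S | ~~ good k i S) (4 * L * degree k i S) <= #|S| ^ 2)%N.
  rewrite -mulnn -[X in (_ <= X * _)%N]sum1_card big_distrl /= big_mkcondr /=.
  apply: leq_sum => i iS; case: ifP => //; rewrite /good iS /= -ltnNge mul1n.
  exact: ltnW.
have split1 : (\sum_(i in S) degree k i S = \sum_(i in S | good k i S) degree k i S
    + \sum_(i in S | ~~ good k i S) degree k i S)%N by rewrite (bigID (good k ^~ S)).
(* The pairs lost here have a second index that is not good; by symmetry of [bin] they are counted
   by the degrees of these indices. *)
have split2 : (\sum_(i in S | good k i S) degree k i S <=
   good_pairs k S + \sum_(j in S | ~~ good k j S) degree k j S)%N.
  apply: (@leq_trans (good_pairs k S + \sum_(i in S | good k i S)
      #|[set j in S | (bin i j == k) && ~~ good k j S]|)).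
    rewrite /good_pairs -big_split /=; apply: leq_sum => i _.
    rewrite /degree -cardsUI; apply: leq_trans (leq_addr _ _); apply: subset_leq_card.
    by apply/fintype.subsetP => j; rewrite !inE => /andP[-> ->]; case: good.
  rewrite leq_add2l.
  have cE (A : pred I) : #|[set j in S | A j]%SET| = (\sum_(j in S) (A j : nat))%N.
    by rewrite -sum1_card [RHS]big_mkcond [LHS]big_mkcond /=; apply: eq_bigr => j _;
      rewrite inE; case: (j \in S) => //=; case: (A j).
  under eq_bigr => i _ do rewrite cE.
  rewrite exchange_big /= [X in (_ <= X)%N]big_mkcondr /=; apply: leq_sum => j jS.
  case: ifP => [_|_]; last by rewrite big1 // => i _; rewrite andbF.
  rewrite /degree cE big_mkcondr /=; apply: leq_sum => i iS; case: ifP => // _.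
  by rewrite andbT bin_sym.
move: pop; rewrite /popular split1; move: dc split2.
rewrite -big_distrr /=; set b := (\sum_(i in S | ~~ _) _)%N; set a := (\sum_(i in S | _) _)%N.
nia.
Qed.

Definition good_weight (w : {set I} -> R) (X : {set {set I}}) k i : R :=
  \sum_(S in X | good k i S) w S.

(** Pigeonholing over multiplicity [2 ^ m] and angle scale [k] selects the atoms [X]; averaging the
    pairs of good incidences over their first index then gives the centre [o]. The heavy tubes keep
    the average share of the shading, up to powers of [L]. *)
Lemma find_center (w : {set I} -> R) (Lam : R) :
  (forall S, 0 <= w S) -> 0 < Lam -> Lam <= \sum_S w S * #|S|%:R ->
  (#|I| < 2 ^ L)%N ->
  exists (m k : 'I_L) (X : {set {set I}}) (o : I),
    let heavy j := Lam <= 16 * L%:R ^+ 3 * #|I|%:R * good_weight w X k j in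
    [/\ forall S, S \in X -> S != finset.set0 /\ (2 ^ m <= #|S|)%N,
        Lam <= 2 * 2 ^+ m * L%:R ^+ 2 * \sum_(S in X) w S &
        2 ^+ m * Lam <= 4 * L%:R ^+ 3 * #|I|%:R *
          \sum_(j | heavy j && (bin j o == k))
            \sum_(S in X | good k o S && good k j S) w S].
Proof.
move=> w0 Lam0 hLam hI.
pose cond (p : 'I_L * 'I_L) S :=
  [&& S != finset.set0, trunc_log 2 #|S| == p.1 & popular p.2 S].
(* Every nonempty atom belongs to at least one pair of a multiplicity and a scale; [#|I| < 2 ^ L]
   keeps the multiplicities within [L] values. *)
have : Lam <= \sum_(p : 'I_L * 'I_L) \sum_(S | cond p S) w S * #|S|%:R.
  apply: le_trans hLam _.
  under [X in _ <= X]eq_bigr => p _ do rewrite big_mkcond /=.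
  rewrite exchange_big /=; apply: ler_sum => S _.
  have [->|S0] := eqVneq S finset.set0.
    by rewrite cards0 mulr0; apply: sumr_ge0 => p _; case: ifP => // _; rewrite cards0 mulr0.
  have [k pk] := popular_exists S0.
  have mL : (trunc_log 2 #|S| < L)%N.
    rewrite -(ltn_exp2l _ _ (isT : 1 < 2)%N); apply: leq_ltn_trans hI.
    by apply: leq_trans (max_card (mem S)); rewrite trunc_logP // card_gt0.
  rewrite (bigD1 (Ordinal mL, k)) //= /cond /= S0 eqxx pk /= lerDl.
  by apply: sumr_ge0 => p _; case: ifP => // _; rewrite mulr_ge0.
move=> /(pigeonhole Lam0)[[m k] _ /=]; rewrite card_prod card_ord natrM -expr2 => hX.
pose X := [set S | cond (m, k) S]%SET.
have L0 : 0 < L%:R :> R by rewrite ltr0n; exact: leq_ltn_trans (ltn_ord k).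
pose mu : R := 2 ^+ m; have mu0 : 0 < mu by exact: exprn_gt0.
have I0 : (0 < #|I|)%N.
  rewrite lt0n; apply/eqP => I0; move: hLam; rewrite big1 ?leNgt ?Lam0 // => S _.
  suff -> : #|S| = 0%N by rewrite mulr0.
  by apply/eqP; rewrite -leqn0 -I0; exact: max_card.
have XP S : S \in X -> [/\ S != finset.set0, popular k S, mu <= #|S|%:R & #|S|%:R <= 2 * mu].
  rewrite inE => /and3P[S0 /eqP lg pk]; split=> //.
    by rewrite /mu -natrX ler_nat -lg trunc_logP // card_gt0.
  by rewrite /mu -exprS -natrX ler_nat -lg; apply: ltnW; exact: trunc_log_ltn.
have {}hX : Lam <= L%:R ^+ 2 * \sum_(S in X) w S * #|S|%:R.
  apply: le_trans hX _; rewrite le_eqVlt; apply/orP; left; apply/eqP.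
  by congr (_ * _); apply: eq_bigl => S; rewrite inE.
have goodE i S : (i \in S) && good k i S = good k i S by rewrite /good andbA andbb.
pose E i j := (bin i j == k)%:R *
   \sum_(S in X) w S * (good k i S && good k j S)%:R.
have E0 i j : 0 <= E i j.
  by rewrite mulr_ge0 ?ler0n //; apply: sumr_ge0 => S _; rewrite mulr_ge0 ?ler0n.
have Esym i j : E i j = E j i.
  by rewrite /E bin_sym; congr (_ * _); apply: eq_bigr => S _; rewrite andbC.
have total : mu * Lam <= 2 * L%:R ^+ 3 * \sum_i \sum_j E i j.
  have -> : \sum_i \sum_j E i j = \sum_(S in X) w S * (good_pairs k S)%:R.
    rewrite /E; under eq_bigr => i _ do under eq_bigr => j _ do rewrite big_distrr /=.
    under eq_bigr => i _ do rewrite exchange_big /=.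
    rewrite exchange_big /=; apply: eq_bigr => S _.
    rewrite /good_pairs natr_sum big_distrr /= [RHS]big_mkcond /=; apply: eq_bigr => i _.
    rewrite goodE; case: ifP => gi; last by rewrite big1 // => j _; rewrite /= mulr0n !mulr0.
    rewrite -sum1_card natr_sum big_distrr /= [RHS]big_mkcond /=; apply: eq_bigr => j _.
    rewrite inE andbCA goodE; case: eqP => _; rewrite /= ?mulr0n ?mul0r // mulr1n mul1r.
    by case: (good k j S); rewrite /= ?mulr1n ?mulr0n ?mulr1 ?mulr0.
  apply: (@le_trans _ _ (L%:R ^+ 2 * \sum_(S in X) w S * (mu * #|S|%:R))).
    have -> : \sum_(S in X) w S * (mu * #|S|%:R) = mu * \sum_(S in X) w S * #|S|%:R.
      by rewrite big_distrr; apply: eq_bigr => S _; rewrite /= mulrCA.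
    by rewrite mulrCA ler_pM2l.
  set PG := \sum_(S in X) w S * (good_pairs k S)%:R.
  have -> : 2 * L%:R ^+ 3 * PG = L%:R ^+ 2 * (2 * L%:R * PG) by ring.
  apply: ler_wpM2l; first exact: sqr_ge0.
  rewrite big_distrr /=; apply: ler_sum => S SX.
  rewrite [X in _ <= X]mulrCA; apply: ler_wpM2l => //; have [_ pS S1 _] := XP _ SX.
  apply: (@le_trans _ _ (#|S|%:R ^+ 2)).
    by rewrite expr2 ler_wpM2r.
  by rewrite -natrX -!natrM ler_nat; exact: many_good_pairs.
have c16 : 0 < 16 * L%:R ^+ 3 * #|I|%:R :> R.
  by apply: mulr_gt0; [apply: mulr_gt0 => //; exact: exprn_gt0|rewrite ltr0n].
set heavy := fun j => Lam <= 16 * L%:R ^+ 3 * #|I|%:R * good_weight w X k j.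
(* Each atom meets at most [2 * mu] tubes, so a row is at most [2 * mu] times the good weight of its
   index. *)
have light_row i : ~~ heavy i -> \sum_j E i j <= 2 * mu * (Lam / (16 * L%:R ^+ 3 * #|I|%:R)).
  rewrite -ltNge mulrC -ltr_pdivlMr //.
  move=> gi; apply: (@le_trans _ _ (2 * mu * good_weight w X k i)); last first.
    by rewrite ler_pM2l ?mulr_gt0 // ltW.
  rewrite /good_weight /E big_distrr /= [X in _ <= X]big_mkcondr /=.
  under eq_bigr => j _ do rewrite big_distrr /=.
  rewrite exchange_big /=; apply: ler_sum => S SX; case: ifP => g1; last first.
    by rewrite big1 // => j _; rewrite /= ?mulr0n !mulr0.
  have [_ _ _ S2] := XP _ SX.
  apply: (@le_trans _ _ (#|S|%:R * w S)); last exact: ler_wpM2r.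
  rewrite -sum1_card natr_sum big_distrl /= [X in _ <= X]big_mkcond /=.
  apply: ler_sum => j _; rewrite -(goodE j); case: (j \in S); rewrite /= ?mulr0n ?mulr0 // mul1r.
  by case: (_ == k); case: (good _ _ _); rewrite /= ?mulr0n ?mulr1n ?mul0r ?mul1r ?mulr0 ?mulr1.
have light : \sum_(i | ~~ heavy i) \sum_j E i j <= mu * Lam / (8 * L%:R ^+ 3).
  apply: le_trans (ler_sum _ light_row) _; rewrite sumr_const -[X in X <= _]mulr_natl.
  apply: (@le_trans _ _ (#|I|%:R * (2 * mu * (Lam / (16 * L%:R ^+ 3 * #|I|%:R))))).
    apply: ler_wpM2r; last by rewrite ler_nat max_card.
    by apply: ltW; apply: mulr_gt0; [exact: mulr_gt0|exact: divr_gt0].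
  rewrite le_eqVlt; apply/orP; left; apply/eqP; field.
  by rewrite lt0r_neq0 //= lt0r_neq0 // ltr0n.
(* Of the total [mu * Lam / (2 * L ^ 3)], the light rows and, by symmetry of [E], the light columns
   take at most a quarter each. *)
have heavy_pairs : mu * Lam / (4 * L%:R ^+ 3) <=
    \sum_(i | heavy i) \sum_(j | heavy j) E i j.
  have t1 : \sum_i \sum_j E i j =
      \sum_(i | heavy i) \sum_j E i j + \sum_(i | ~~ heavy i) \sum_j E i j.
    exact: bigID.
  have t2 : \sum_(i | heavy i) \sum_j E i j <= \sum_(i | heavy i) \sum_(j | heavy j) E i j +
      \sum_(i | ~~ heavy i) \sum_j E i j.
    under [X in X <= _]eq_bigr => i _ do rewrite (bigID heavy) /=.
    rewrite big_split /= lerD2l exchange_big /=; apply: ler_sum => j _.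
    rewrite big_mkcond /=; apply: ler_sum => i _; case: ifP => // _.
    by rewrite Esym.
  have : mu * Lam / (2 * L%:R ^+ 3) <= \sum_i \sum_j E i j.
    by rewrite ler_pdivrMr ?mulr_gt0 ?exprn_gt0 // [X in _ <= X]mulrC.
  have -> : mu * Lam / (2 * L%:R ^+ 3) = mu * Lam / (4 * L%:R ^+ 3) + 2 * (mu * Lam / (8 * L%:R ^+ 3)).
    by field; exact: lt0r_neq0.
  lra.
have c0 : 0 < mu * Lam / (4 * L%:R ^+ 3) by rewrite divr_gt0 ?mulr_gt0 ?exprn_gt0.
case: (pigeonhole c0 heavy_pairs) => o _ ho.
exists m, k, X, o; split.
- by move=> S SX; have [S0 _ + _] := XP _ SX; rewrite /mu -natrX ler_nat.
- apply: le_trans hX _; set W := \sum_(S in X) w S.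
  have -> : 2 * 2 ^+ m * L%:R ^+ 2 * W = L%:R ^+ 2 * (2 * mu * W) by rewrite /mu; ring.
  apply: ler_wpM2l; first exact: sqr_ge0.
  rewrite /W big_distrr /=; apply: ler_sum => S SX.
  by rewrite mulrC ler_wpM2r //; have [] := XP _ SX.
- have Fo : \sum_(j | heavy j) E o j = \sum_(j | heavy j && (bin j o == k))
      \sum_(S in X | good k o S && good k j S) w S.
    rewrite [RHS]big_mkcondr /=; apply: eq_bigr => j _.
    rewrite /E bin_sym; case: eqP => _; last by rewrite mulr0n mul0r.
    rewrite mulr1n mul1r [RHS]big_mkcondr /=; apply: eq_bigr => S _.
    by case: ifP; rewrite ?mulr1n ?mulr1 ?mulr0n ?mulr0.
  move: ho; rewrite Fo ler_pdivrMr ?mulr_gt0 ?exprn_gt0 // => /le_trans; apply.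
  by rewrite mulrC mulrA.
Qed.
End Incidences.

(** * The hairbrush argument: multiplicity and volume of the union *)

Section Core.
Variables (R : realType) (I : finType) (a v : I -> R3 R) (d K : R) (L : nat).
Variable bin : I -> I -> 'I_L.
Local Notation T i := (tube d (a i) (v i)).
Local Notation ang i j := (enorm (cross3 (v i) (v j))).
Local Notation scale k := (2 ^+ nat_of_ord k * d).
Hypotheses (d0 : 0 < d) (d1 : d <= 1) (v1 : forall i, enorm (v i) = 1).
Hypothesis Tball : forall i, T i `<=` @unit_ball R.
Hypothesis bin_le : forall i j, ang i j <= scale (bin i j).
Hypothesis bin_ge :
  forall i j, bin i j = 0%N :> nat \/ scale (bin i j) <= 2 * ang i j.
Hypothesis few_in_plate : forall p n (r1 : R) a' v' (r2 : R) (H : {set I}),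
  0 < r1 -> 0 < r2 -> enorm v' = 1 -> enorm n = 1 -> dot3 v' n = 0 ->
  (forall i, i \in H -> T i `<=` plate p n r1 a' v' r2) ->
  #|H|%:R <= K * (r1 * r2 / d ^+ 2).


Hypothesis bin_sym : forall i j, bin i j = bin j i.
Hypothesis few_in_slab : forall n (c r : R) (H : {set I}), enorm n = 1 -> 0 < r ->
  (forall i, i \in H -> T i `<=` @unit_ball R `&` thicken r (plane n c)) ->
  #|H|%:R <= K * (r * #|I|%:R).

(** Such a tube is reached from [T o] in two steps at angle at most [scale k], so it stays within
    [8 * scale k] of the axis of [T o]. Any plane through this axis gives the slab; the [9] leaves
    room for its open neighbourhood. *)
Lemma few_near (o : I) (k : 'I_L) (H : {set I}) :
  (forall i, i \in H -> exists j, [/\ (T j `&` T o) !=set0, bin j o = k,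
      bin j i = k & (T i `&` T j) !=set0]) ->
  #|H|%:R <= K * (9 * scale k * #|I|%:R).
Proof.
move=> hH; have [n n1 vn] := orth_unit (v1 o).
have dk : d <= scale k by rewrite ler_peMl ?(ltW d0) // exprn_ege1 // ler1n.
have r0 : 0 < 9 * scale k by apply: mulr_gt0 => //; exact: lt_le_trans dk.
apply: (few_in_slab (n := n) (c := dot3 (a o) n)) => // i iH x xT.
split; first exact: Tball xT.
have [j [[z [zj zo]] bo bi [y [yi yj]]]] := hH _ iH.
have a1 : ang j o <= scale k by rewrite -bo.
have a2 : ang i j <= scale k by rewrite crossC_norm -bi.
have a3 : ang i o <= 2 * scale k.
  by have := cross_triangle (v1 i) (v1 j) (v1 o); lra.
have h1 := tube_meets (v1 o) zo zj yj.
have [s s1 hs] := tube_diff xT yi.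
have cx : enorm (cross3 (x - a o) (v o)) <= 8 * scale k.
  have -> : cross3 (x - a o) (v o) = cross3 (y - a o) (v o) + s *: cross3 (v i) (v o)
      + cross3 (x - y - s *: v i) (v o).
    rewrite -crossZl -!crossDl; congr (cross3 _ _).
    by congr (_, _, _); rewrite /= /GRing.scale /=; ring.
  have := enormD (cross3 (y - a o) (v o) + s *: cross3 (v i) (v o))
    (cross3 (x - y - s *: v i) (v o)).
  have := enormD (cross3 (y - a o) (v o)) (s *: cross3 (v i) (v o)).
  have := enorm_cross (x - y - s *: v i) (v o); rewrite (v1 o) mulr1.
  rewrite enormZ; have := ler_wpM2r (enorm_ge0 (cross3 (v i) (v o))) s1; lra.
have := le_trans (dot_le_cross _ (v1 o) n1 vn) cx; set t := dot3 (x - a o) n => ht.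
exists (x - t *: n).
  by rewrite /plane /= dotBr dotZr (enorm_eq1 n1) /t dotBl (dotC n x); ring.
rewrite opprB addrC subrK enormZ n1 mulr1; lra.
Qed.

(* [mu] is the typical multiplicity, [s] the typical angle, [h] the number of
   tubes in the hairbrush, and [u] the volume of its shading. *)
Lemma multiplicity_bound (lam V : R) (Y : I -> set (R3 R)) :
  (forall i, lebesgue_measurable3 (Y i)) -> (forall i, Y i `<=` T i) ->
  0 < lam -> lam <= 1 -> (0 < #|I|)%N ->
  lam * (#|I|%:R * d ^+ 2) <= \sum_i fine (vol (Y i)) ->
  (#|I| < 2 ^ L)%N -> (vol (\bigcup_i Y i) <= V%:E)%E ->
  exists (mu s u h : R), [/\ 0 < mu, 0 < s, 0 <= u,
    lam * (#|I|%:R * d ^+ 2) <= 2 * mu * L%:R ^+ 2 * V &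
   [/\ mu * (lam * d ^+ 2) <= 4 * L%:R ^+ 3 * (h * (32 * 12 ^+ 3 * (d ^+ 3 / s))),
     h * (d ^+ 2 * (lam / (16 * L%:R ^+ 3)) ^+ 3) <= hairbrush_const R * (L%:R * (K * u)) &
     u * mu <= 4 * L%:R * (K * (9 * s * #|I|%:R) * (12 ^+ 4 * d ^+ 2))]].
Proof.
move=> mY YT lam0 lam1 I0 hlam hI hV.
have Yball i : Y i `<=` @unit_ball R by exact: subset_trans (@Tball i).
have [w w0 hw] := atoms mY Yball.
have wfine P : ~~ P finset.set0 ->
    fine (vol [set x | P (incidence Y x)]) = \sum_(S | P S) w S.
  by move=> P0; rewrite hw.
have wY i : fine (vol (Y i)) = \sum_(S : {set I} | i \in S) w S.
  rewrite -(wfine (fun S => i \in S)) ?inE //; congr (fine (vol _)).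
  by apply/seteqP; split => x /= /in_incidence.
(* An atom of nonzero weight contains an actual point, at which its tubes meet. *)
have watom S : S != finset.set0 -> w S != 0 -> exists x, incidence Y x = S.
  move=> S0 wS; apply: contrapT => nx; move/eqP: wS; apply.
  have := @wfine (pred1 S); rewrite big_pred1_eq => <-; last by rewrite /= eq_sym.
  suff -> : [set x | pred1 S (incidence Y x)] = set0.
    exact: (congr1 fine (outer_measure0 _)).
  by apply/seteqP; split => // x /= /eqP h; case: nx; exists x.
have sc (A : {set I}) (t : R) : #|A|%:R * t = \sum_(j in A) t.
    by rewrite sumr_const mulr_natl.
have N0 : 0 < #|I|%:R :> R by rewrite ltr0n.
have d20 : 0 < d ^+ 2 by exact: exprn_gt0.
have Lam0 : 0 < lam * (#|I|%:R * d ^+ 2) by rewrite mulr_gt0 // mulr_gt0.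
have hLam : lam * (#|I|%:R * d ^+ 2) <= \sum_S w S * #|S|%:R.
  apply: le_trans hlam _; rewrite (eq_bigr _ (fun i _ => wY i)).
  rewrite (exchange_big_dep predT) //= le_eqVlt; apply/orP; left; apply/eqP.
  by apply: eq_bigr => S _; rewrite sumr_const mulr_natr.
have [m [k [X [c [hX1 hX2 hX3]]]]] := find_center bin_sym w0 Lam0 hLam hI.
have L0 : 0 < L%:R :> R by rewrite ltr0n; exact: leq_ltn_trans (ltn_ord k).
have X0 : finset.set0 \notin X by apply/negP => /hX1[]; rewrite eqxx.
pose Z j := [set x | (incidence Y x \in X) && good bin k j (incidence Y x)].
have ZY j : Z j `<=` Y j by move=> x /andP[_ /andP[/in_incidence]].
have gwZ j : fine (vol (Z j)) = good_weight bin w X k j.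
  by apply: (wfine (fun S => (S \in X) && good bin k j S)); rewrite (negbTE X0).
(* Heaviness in [find_center], after division by [#|I|], says that the good part of the shading has
   volume at least [tau * d ^+ 2]. *)
pose tau := lam / (16 * L%:R ^+ 3).
have c16 : 0 < 16 * L%:R ^+ 3 :> R by apply: mulr_gt0 => //; exact: exprn_gt0.
pose H := [set j | [&& tau * d ^+ 2 <= good_weight bin w X k j, bin j c == k &
   `[< (T j `&` T c) !=set0 >]]]%SET.
have HP j : j \in H -> [/\ tau * d ^+ 2 <= good_weight bin w X k j, bin j c = k &
    (T j `&` T c) !=set0].
  by rewrite inE => /and3P[-> /eqP -> /asboolP].
pose Q := [set S in X | [exists j in H, good bin k j S]]%SET.
exists (2 ^+ m), (scale k), (\sum_(S in Q) w S), #|H|%:R; split.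
- exact: exprn_gt0.
- by apply: mulr_gt0 => //; exact: exprn_gt0.
- exact: sumr_ge0.
- apply: le_trans hX2 _; apply: ler_wpM2l.
    by rewrite mulr_ge0 ?sqr_ge0 // mulr_ge0 // exprn_ge0.
  rewrite -lee_fin -(hw (fun S => S \in X)) //; apply: le_trans hV; apply: le_vol => x /=.
  by move=> /hX1[/finset.set0Pn[j /in_incidence Yj] _]; exists j.
split.
(* By [hX3] the heavy tubes at scale [k] share much mass with [T c]. Each contributes at most the
   volume of its intersection with [T c], and nothing unless it belongs to [H]. *)
- rewrite -(ler_pM2l N0).
  have -> : #|I|%:R * (2 ^+ m * (lam * d ^+ 2)) = 2 ^+ m * (lam * (#|I|%:R * d ^+ 2)).
    by ring.
  apply: le_trans hX3 _.
  have -> : 4 * L%:R ^+ 3 * #|I|%:R = #|I|%:R * (4 * L%:R ^+ 3) :> R by ring.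
  rewrite -mulrA; apply: ler_wpM2l; first exact: ltW.
  apply: ler_wpM2l; first by rewrite mulr_ge0 // exprn_ge0.
  rewrite sc [X in _ <= X]big_mkcond [X in X <= _]big_mkcond /=.
  apply: ler_sum => j _.
  have c0 : 0 <= 32 * 12 ^+ 3 * (d ^+ 3 / scale k).
    apply: mulr_ge0; first by apply: mulr_ge0 => //; exact: exprn_ge0.
    apply: divr_ge0; first exact: exprn_ge0 (ltW _).
    by apply: mulr_ge0; [exact: exprn_ge0|exact: ltW].
  case: ifP => [/andP[hj bj]|_]; last by case: ifP.
  have -> : \sum_(S in X | good bin k c S && good bin k j S) w S =
      fine (vol (Z c `&` Z j)).
    apply: esym; apply: (etrans _ (wfine (fun S => (S \in X) && (good bin k c S && good bin k j S)) _));
      last by rewrite (negbTE X0).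
    congr (fine (vol _)); apply/seteqP; split => x /=.
      by move=> [/andP[h1 h2] /andP[_ h3]]; rewrite h1 h2 h3.
    by move=> /and3P[h1 h2 h3]; rewrite /Z /= h1 h2 h3.
  have ZT : Z c `&` Z j `<=` T j `&` T c by move=> x [/ZY/YT ? /ZY/YT].
  case: ifPn => [_|].
    rewrite fine_vol_le; last by move=> x [/ZY/Yball].
    by apply: le_trans (le_vol ZT) _; rewrite -(eqP bj); exact: vol_tubeI_bin.
  rewrite inE bj /=.
  have -> : tau * d ^+ 2 <= good_weight bin w X k j.
    rewrite /tau mulrAC ler_pdivrMr // -(ler_pM2l N0); move: hj; congr (_ <= _); ring.
  move=> /= /asboolPn ne; have -> : Z c `&` Z j = set0.
    by apply/seteqP; split=> // x /ZT Tx; apply: ne; exists x.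
  by rewrite (congr1 fine (outer_measure0 _)).
- apply: (hairbrush d0 d1 v1 Tball bin_le bin_ge few_in_plate (tau := tau) (o := c) (k := k) (Z := Z)) => //.
  + by rewrite divr_gt0.
  + rewrite ler_pdivrMr // mul1r; apply: le_trans lam1 _.
    have := exprn_ege1 3 (_ : 1 <= L%:R :> R); rewrite ler1n -(ltr0n R) => /(_ L0); lra.
  + by move=> i /HP[].
  + move=> i; exact: (incidence_cara (fun S => (S \in X) && good bin k i S)).
  + by move=> i /HP[h _ _]; split; [exact: subset_trans (YT i)|rewrite gwZ].
  + have := hw (fun S => S \in Q); rewrite inE (negbTE X0) => <- //.
    apply: le_vol => x [j /= jH /andP[xX xg]]; rewrite inE xX /=.
    by apply/existsP; exists j; rewrite jH.
(* [Phi] collects the tubes that meet the hairbrush at scale [k]; the total volume of their shadings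
   is compared with the volume of [Q]. *)
- pose Phi := [set i | [exists j in H, (bin j i == k) && `[< (T i `&` T j) !=set0 >]]]%SET.
  have PhiN : #|Phi|%:R <= K * (9 * scale k * #|I|%:R).
    apply: (few_near (o := c)) => i; rewrite inE => /existsP[j /and3P[jH /eqP bi /asboolP me]].
    by have [_ ? ?] := HP _ jH; exists j.
  have YPhi : \sum_(S in Q) w S * #|S :&: Phi|%:R <= #|Phi|%:R * (12 ^+ 4 * d ^+ 2).
    apply: (@le_trans _ _ (\sum_(i in Phi) fine (vol (Y i)))); last first.
      rewrite sc; apply: ler_sum => i _.
      rewrite fine_vol_le //; apply: le_trans (le_vol (@YT i)) _.
      exact: vol_tube_le.
    rewrite (eq_bigr _ (fun i _ => wY i)) (exchange_big_dep predT) //=.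
    rewrite big_mkcond /=; apply: ler_sum => S _.
    have E : \sum_(i in Phi | i \in S) w S = w S * #|S :&: Phi|%:R.
      rewrite mulrC sc; apply: eq_bigl => i.
      by rewrite finset.in_setI andbC.
    by rewrite E; case: ifP => // _; rewrite mulr_ge0.
  (* At a point of [Q] some [j] in [H] is good: at least a fraction [1 / (4 * L)] of the tubes
     through this point make an angle of scale [k] with [T j]. They meet [T j] there, hence lie in
     [Phi]. *)
  have step : (\sum_(S in Q) w S) * 2 ^+ m <=
      4 * L%:R * \sum_(S in Q) w S * #|S :&: Phi|%:R.
    rewrite big_distrl big_distrr /=; apply: ler_sum => S.
    rewrite inE => /andP[SX /existsP[j /andP[jH gj]]]; have [S0 mS] := hX1 _ SX.
    have [->|wS] := eqVneq (w S) 0; first by rewrite !mul0r mulr0.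
    rewrite [X in _ <= X]mulrCA; apply: ler_wpM2l => //.
    have [x xS] := watom _ S0 wS.
    rewrite -natrX -!natrM ler_nat; apply: leq_trans mS _.
    case/andP: gj => jS /leq_trans; apply; rewrite leq_mul2l; apply/orP; right.
    apply: subset_leq_card; apply/fintype.subsetP => i; rewrite !inE => /andP[iS bi].
    rewrite iS /=; apply/existsP; exists j; rewrite jH bi /=; apply/asboolP.
    by exists x; split; apply: YT; apply/in_incidence; rewrite xS.
  apply: le_trans step _; apply: ler_wpM2l; first by rewrite mulr_ge0.
  apply: le_trans YPhi _; apply: ler_wpM2r PhiN.
  by apply: mulr_ge0; [exact: exprn_ge0|exact: sqr_ge0].
Qed.

(** Elimination of the four auxiliary quantities: [h] and [u] are chained away, the angle [s]
    cancels, and what remains bounds [mu ^+ 2] by about [#|I| * d]. With the lower bound of [V] by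
    [#|I| * d ^+ 2 / mu] this gives the claim. *)
Lemma volume_bound (lam V : R) (Y : I -> set (R3 R)) :
  (forall i, lebesgue_measurable3 (Y i)) -> (forall i, Y i `<=` T i) ->
  0 < lam -> lam <= 1 -> (0 < #|I|)%N ->
  lam * (#|I|%:R * d ^+ 2) <= \sum_i fine (vol (Y i)) ->
  (#|I| < 2 ^ L)%N -> (vol (\bigcup_i Y i) <= V%:E)%E ->
  lam ^+ 6 * (#|I|%:R * d ^+ 3) <=
    4 * 16 ^+ 3 * (144 * (32 * 12 ^+ 3) * 12 ^+ 4 * hairbrush_const R) *
      (L%:R ^+ 18 * (K ^+ 2 * V ^+ 2)).
Proof.
move=> mY YT lam0 lam1 I0 hlam hI hV.
have [mu [s [u [h [mu0 s0 u0 ha [hb hc hd]]]]]] :=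
  multiplicity_bound mY YT lam0 lam1 I0 hlam hI hV.
have h0 : 0 <= hairbrush_const R.
  apply: addr_ge0; first by apply: mulr_ge0 => //; exact: sqr_ge0.
  by rewrite -!natrX -!natrM ler0n.
have N0 : 0 < #|I|%:R :> R by rewrite ltr0n.
have L0 : 0 < L%:R :> R.
  by case/card_gt0P: I0 => i _; rewrite ltr0n; exact: leq_ltn_trans (ltn_ord (bin i i)).
have K0 : 0 <= K by case/card_gt0P: I0 => i _; exact: (bound_ge0 d0 v1 few_in_plate i).
have V0 : 0 <= V by rewrite -lee_fin (le_trans (vol_ge0 _) hV).
have C10 : 0 <= 32 * 12 ^+ 3 :> R by apply: mulr_ge0 => //; exact: exprn_ge0.
have C20 : 0 <= 12 ^+ 4 :> R by exact: exprn_ge0.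
move: hb hc hd; move: (32 * 12 ^+ 3) C10 (12 ^+ 4) C20 (hairbrush_const R) h0.
move=> C1 C10 C2 C20 Ch Ch0 hb hc hd.
move: (L%:R) L0 (#|I|%:R) N0 ha hb hc hd => l l0 N N0 ha hb hc hd {hlam}.
have e1 : mu * lam * s <= 4 * C1 * l ^+ 3 * (h * d).
  rewrite -(ler_pM2l (exprn_gt0 2 d0)).
  have := ler_wpM2r (ltW s0) hb; congr (_ <= _); first by ring.
  by field; exact: lt0r_neq0.
set tau := lam / (16 * l ^+ 3) in hc.
have l3 : 0 < 16 * l ^+ 3 by apply: mulr_gt0 => //; exact: exprn_gt0.
have t0 : 0 < tau by exact: divr_gt0.
have tE : tau * (16 * l ^+ 3) = lam by rewrite /tau divfK // lt0r_neq0.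
have e2 : mu * lam * s * (d * tau ^+ 3) <= 4 * C1 * l ^+ 4 * (Ch * (K * u)).
  have p1 : 0 <= d * tau ^+ 3 by rewrite mulr_ge0 ?exprn_ge0 ?(ltW d0) ?(ltW t0).
  apply: le_trans (ler_wpM2r p1 e1) _.
  have p2 : 0 <= 4 * C1 * l ^+ 3 by rewrite mulr_ge0 ?mulr_ge0 ?exprn_ge0 ?(ltW l0).
  by have := ler_wpM2l p2 hc; congr (_ <= _); ring.
have e3 : mu ^+ 2 * lam * tau ^+ 3 <= 144 * C1 * C2 * Ch * (l ^+ 5 * (K ^+ 2 * (N * d))).
  rewrite -(ler_pM2l (mulr_gt0 s0 d0)).
  have p1 : 0 <= 4 * C1 * l ^+ 4 * (Ch * K).
    by rewrite !mulr_ge0 ?exprn_ge0 ?(ltW l0).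
  have := ler_wpM2l p1 hd; have := ler_wpM2r (ltW mu0) e2.
  have -> : 4 * C1 * l ^+ 4 * (Ch * (K * u)) * mu = 4 * C1 * l ^+ 4 * (Ch * K) * (u * mu).
    by ring.
  move=> i1 /(le_trans i1); congr (_ <= _); ring.
have e4 : mu ^+ 2 * lam ^+ 4 <=
    16 ^+ 3 * (144 * C1 * C2 * Ch) * (l ^+ 14 * (K ^+ 2 * (N * d))).
  have := ler_wpM2l (ltW (exprn_gt0 3 l3)) e3; congr (_ <= _); last by ring.
  by rewrite -[in RHS]tE; rewrite -{1}tE; ring.
have e5 : lam ^+ 2 * (N ^+ 2 * d ^+ 4) <= 4 * mu ^+ 2 * l ^+ 4 * V ^+ 2.
  have p : 0 <= lam * (N * d ^+ 2).
    by rewrite !mulr_ge0 ?exprn_ge0 ?(ltW N0) ?(ltW d0) ?(ltW lam0).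
  have := ler_pM p p ha ha; congr (_ <= _); ring.
rewrite -(ler_pM2l (mulr_gt0 N0 d0)).
have p4 : 0 <= lam ^+ 4 by rewrite exprn_ge0 ?(ltW lam0).
have p5 : 0 <= 4 * l ^+ 4 * V ^+ 2 by rewrite mulr_ge0 ?mulr_ge0 ?exprn_ge0 ?(ltW l0).
have := ler_wpM2l p5 e4; have := ler_wpM2r p4 e5.
have -> : 4 * mu ^+ 2 * l ^+ 4 * V ^+ 2 * lam ^+ 4 =
  4 * l ^+ 4 * V ^+ 2 * (mu ^+ 2 * lam ^+ 4) by ring.
move=> i1 /(le_trans i1); congr (_ <= _); ring.
Qed.
End Core.

(** * Cardinalities, dyadic scales and logarithms *)

Lemma card_le_counting (R : realType) (T : choiceType) (I : finType) (f : I -> T)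
    (A : set T) (H : {set I}) : injective f -> (forall i, i \in H -> A (f i)) ->
  ((#|H|%:R)%:E <= counting A :> \bar R)%E.
Proof.
move=> finj fH; rewrite /counting; case: ifPn => [/asboolP finA|_]; last exact: leey.
rewrite lee_fin ler_nat cardE -(size_map f); apply: uniq_leq_size.
  by rewrite map_inj_uniq // enum_uniq.
move=> x /mapP[i]; rewrite mem_enum => iH ->; rewrite in_fset_set // inE.
exact: fH.
Qed.

(** [f x] is the least admissible exponent; if it is positive, minimality gives the reverse
    bound. *)
Lemma dyadic_scale (R : realType) (d : R) (L : nat) : 0 < d -> (0 < L)%N ->
  1 <= 2 ^+ L.-1 * d ->
  exists f : R -> 'I_L, forall x, x <= 1 ->
    x <= 2 ^+ f x * d /\ (f x = 0%N :> nat \/ 2 ^+ f x * d <= 2 * x).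
Proof.
move=> d0 L0 dL.
suff /boolp.choice[f hf] : forall x, exists k : 'I_L, x <= 1 -> x <= 2 ^+ k * d /\
     (k = 0%N :> nat \/ 2 ^+ k * d <= 2 * x) by exists f.
move=> x; have [x1|x1] := leP x 1; last by exists (Ordinal L0).
  have ex : exists k, x <= 2 ^+ k * d by exists L.-1; exact: le_trans dL.
  have kL : (ex_minn ex < L)%N.
    case: ex_minnP => k _ /(_ L.-1 (le_trans x1 dL)) h.
    by apply: leq_ltn_trans h _; rewrite prednK.
  exists (Ordinal kL) => _ /=; case: ex_minnP => -[|k] hk mk; split=> //; first by left.
  right; have : ~~ (x <= 2 ^+ k * d) by apply/negP => /mk; rewrite ltnn.
  by rewrite -ltNge exprS; lra.
Qed.

Lemma dyadic_length (R : realType) (A : R) : 1 <= A ->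
  exists2 L : nat, (0 < L)%N & A <= 2 ^+ L.-1 /\ 2 ^+ L <= 4 * A.
Proof.
move=> A1; have A0 : 0 <= A by apply: le_trans A1.
have /andP[t1 t2] := truncn_itv A0; set t := Num.truncn A in t1 t2.
have t0 : (0 < t)%N by rewrite -ltnS -(ltr_nat R); apply: le_lt_trans t2.
have /andP[l1 l2] := trunc_log_bounds (isT : 1 < 2)%N t0.
(* One unit makes the power exceed the truncated value of [A], the other compensates the predecessor
   in [L.-1]. *)
exists (trunc_log 2 t).+2 => //=; split.
  by apply: le_trans (ltW t2) _; rewrite -natrX ler_nat.
have : 2 ^+ trunc_log 2 t <= A by apply: le_trans t1; rewrite -natrX ler_nat.
by rewrite 2!exprS; lra.
Qed.

(** Logarithmic losses are absorbed into an arbitrarily small power, by [1 + x <= exp x]. *)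
Lemma log_le_powR (R : realType) (L : nat) (A b : R) : 0 < b -> 2 ^+ L <= A ->
  L%:R <= (b * ln 2)^-1 * A `^ b.
Proof.
move=> b0 LA; have l2 : 0 < ln 2 :> R by rewrite ln_gt0 // ltr1n.
have p : 0 < 2 ^+ L :> R by exact: exprn_gt0.
have h : L%:R * (b * ln 2) <= A `^ b.
  apply: (@le_trans _ _ ((2 ^+ L) `^ b)); last first.
    by apply: ge0_ler_powR => //; rewrite ?nnegrE ltW // (lt_le_trans p).
  rewrite /powR gt_eqF // lnXn // -[ln 2 *+ L]mulr_natl.
  have -> : L%:R * (b * ln 2) = b * (L%:R * ln 2) by ring.
  by apply: le_trans (expR_ge1Dx _); rewrite lerDr.
by rewrite mulrC ler_pdivlMr // mulr_gt0.
Qed.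

(** * The volume estimate *)

Lemma powR_anti (R : realType) (x r s : R) : 0 < x -> x <= 1 -> r <= s ->
  x `^ s <= x `^ r.
Proof.
move=> x0 x1 rs; rewrite /powR gt_eqF // ler_expR.
by apply: ler_wnM2r => //; exact: ln_le0.
Qed.

(** The infimum need not be attained, hence the factor [2]. *)
Lemma constant_of_inf (R : realType) (P : R -> Prop) (c : R) : 0 < c ->
  (ereal_inf [set C%:E | C in [set C : R | (0 < C)%R /\ P C]] <= c%:E)%E ->
  exists C : R, [/\ 0 < C, C <= 2 * c & P C].
Proof.
move=> c0 hc; have c2 : (c%:E < (2 * c)%:E)%E by rewrite lte_fin; lra.
have [_ [C [C0 PC] <-]] := ereal_inf_lt (le_lt_trans hc c2).
by rewrite lte_fin => hC; exists C; split=> //; exact: ltW.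
Qed.

Definition e_x (R : realType) : R3 R := ((1, 0), 0).

Definition e_z (R : realType) : R3 R := ((0, 0), 1).

Lemma enorm_ex (R : realType) : enorm (e_x R) = 1.
Proof. by rewrite /enorm /dot3 /= !mul0r !addr0 mulr1 sqrtr1. Qed.

Lemma enorm_ez (R : realType) : enorm (e_z R) = 1.
Proof. by rewrite /enorm /dot3 /= !mul0r !add0r mulr1 sqrtr1. Qed.

Lemma dot_ez_ex (R : realType) : dot3 (e_z R) (e_x R) = 0.
Proof. by rewrite /dot3 /= !mul0r mulr0 !addr0. Qed.

Lemma tube_vol_bounds (R : realType) (d : R) : 0 < d -> d <= 1 ->
  d ^+ 2 / 8 <= tube_vol d /\ tube_vol d <= 12 ^+ 4 * d ^+ 2.
Proof.
move=> d0 d1; have := vol_tube_ge 0 d0 (enorm_ez R).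
have := vol_tube_le 0 d0 d1 (enorm_ez R).
rewrite -[tube_vol d]/(fine (vol (tube d 0 (e_z R)))).
have [f ->] : exists f, vol (tube d 0 (e_z R)) = f by eexists.
by case: f => [r| |] //=; rewrite !lee_fin.
Qed.

(** Through this plate the Katz-Tao condition bounds the number of all tubes, and in particular
    makes the family finite. *)
Lemma ball_in_plate (R : realType) (A : set (R3 R)) :
  A `<=` @unit_ball R -> A `<=` plate 0 (e_x R) 1 0 (e_z R) 1.
Proof.
move=> AB x /AB xB; split=> //=; rewrite !subr0; move: xB; rewrite /unit_ball /= => xB.
split; first by apply: le_trans (cauchy_schwarz _ _) _; rewrite enorm_ex mulr1.
by apply: le_trans (enorm_cross _ _) _; rewrite enorm_ez mulr1.
Qed.

Section TubeCounts.
Variables (R : realType) (d : R) (TT : set (set (R3 R))) (Y : set (R3 R) -> set (R3 R)).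
Hypotheses (d0 : 0 < d) (shaded : shaded_tubes d TT Y).

Lemma tube_radius_le1 : d <= 1.
Proof.
have [[T0 TT0] tubesT _ _] := shaded.
have [[a [v [v1 ->]]] ball] := tubesT _ TT0.
exact: (@tube_in_ball_le R d a v d0 v1 ball).
Qed.

Lemma plate_count (C : R) p n (r1 : R) a v (r2 : R) : 0 < C ->
  (forall W : set (R3 R), convex_set W ->
    (counting (tubes_in TT W) <= C%:E * vol W * ((tube_vol d)^-1)%:E)%E) ->
  0 < r1 -> 0 < r2 -> enorm v = 1 -> enorm n = 1 -> dot3 v n = 0 ->
  (counting (tubes_in TT (plate p n r1 a v r2)) <=
    (8 * 24 ^+ 3 * C * (r1 * r2 / d ^+ 2))%:E)%E.
Proof.
move=> C0 hC r10 r20 v1 n1 vn.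
have hW := hC _ (@convex_plate R p n r1 a v r2).
apply: le_trans hW _.
have [tv _] := tube_vol_bounds d0 tube_radius_le1.
have d20 : 0 < d ^+ 2 / 8 by rewrite divr_gt0 // exprn_gt0.
have tv0 : 0 < tube_vol d by exact: lt_le_trans tv.
have := vol_plate p a r10 r20 v1 n1 vn.
have : vol (plate p n r1 a v r2) \is a fin_num by apply: fin_vol => x [].
move=> /fineK <-; rewrite lee_fin -!EFinM lee_fin => h.
have i : (tube_vol d)^-1 <= (d ^+ 2 / 8)^-1 by rewrite lef_pV2.
have -> : 8 * 24 ^+ 3 * C * (r1 * r2 / d ^+ 2) =
    C * (24 ^+ 3 * (r1 * r2)) * (d ^+ 2 / 8)^-1 by field; exact: lt0r_neq0.
apply: ler_pM => //; last exact: (ler_wpM2l (ltW C0) h).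
  by apply: mulr_ge0; [exact: ltW|exact: fine_ge0 (vol_ge0 _)].
by rewrite invr_ge0 ltW.
Qed.

End TubeCounts.

Lemma volume_estimate (R : realType) (eta : R) : 0 < eta -> eta <= 1 ->
  exists2 C : R, 0 < C & forall (d : R) TT Y, 0 < d ->
    shaded_tubes d TT Y -> dense_shading (d `^ eta) TT Y ->
    (C_KT_CW d TT <= (d `^ (- eta))%:E)%E -> (C_F_SW TT <= (d `^ (- eta))%:E)%E ->
    fine (counting TT) * d ^+ 3 * (d `^ eta) ^+ 26 <=
      C * fine (vol (\bigcup_(T in TT) Y T)) ^+ 2.
Proof.
move=> eta0 eta1; set c24 : R := 16 * 24 ^+ 3.
have c240 : 0 < c24 by apply: mulr_gt0 => //; exact: exprn_gt0.
set b := eta / 3; have b0 : 0 < b by exact: divr_gt0.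
set cL := (b * ln 2)^-1 * (4 * (c24 + 1)) `^ b.
have cL0 : 0 < cL.
  rewrite mulr_gt0 ?invr_gt0 ?mulr_gt0 ?ln_gt0 ?ltr1n //.
  by rewrite powR_gt0 // mulr_gt0 // addr_gt0.
set C0 := 4 * 16 ^+ 3 * (144 * (32 * 12 ^+ 3) * 12 ^+ 4 * hairbrush_const R).
have C00 : 0 < C0.
  have h : 0 < hairbrush_const R.
    apply: addr_gt0; first by apply: mulr_gt0 => //; apply: exprn_gt0; lra.
    by rewrite -!natrX -!natrM ltr0n.
  have c1 : 0 < 144 * (32 * 12 ^+ 3) * 12 ^+ 4 :> R by rewrite -!natrX -!natrM ltr0n.
  have c2 : 0 < 4 * 16 ^+ 3 :> R by rewrite -!natrX -!natrM ltr0n.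
  exact: mulr_gt0 c2 (mulr_gt0 c1 h).
exists (8 ^+ 6 * (C0 * (cL ^+ 18 * c24 ^+ 2))).
  apply: mulr_gt0; first exact: exprn_gt0.
  by apply: mulr_gt0 => //; apply: mulr_gt0; exact: exprn_gt0.
move=> d TT Y d0 shaded dense KT FS; have d1 := tube_radius_le1 d0 shaded.
have [[T0 TT0] tubesT _ YP] := shaded.
set e := d `^ eta; have e0 : 0 < e by exact: powR_gt0.
have e1 : e <= 1 by rewrite -[X in _ <= X](powRr0 d); apply: powR_anti => //; exact: ltW.
have de : d <= e by rewrite -[X in X <= _](powRr1 (ltW d0)); exact: powR_anti.
have ei : d `^ (- eta) = e^-1 by rewrite powRN.
have ei0 : 0 < e^-1 by rewrite invr_gt0.
rewrite ei in KT FS.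
have [C1 [C10 C12 hC1]] := constant_of_inf ei0 KT.
have [C2 [C20 C22 hC2]] := constant_of_inf ei0 FS.
have TTW : tubes_in TT (plate 0 (e_x R) 1 0 (e_z R) 1) = TT.
  apply/seteqP; split => T; first by case.
  by move=> TTT; split=> //; apply: ball_in_plate; exact: (tubesT _ TTT).2.
have := plate_count d0 shaded 0 0 C10 hC1 ltr01 ltr01 (enorm_ez R) (enorm_ex R) (dot_ez_ex R); rewrite TTW => hN.
have finTT : finite_set TT.
  by apply: contrapT => infTT; move: hN; rewrite /counting asboolF.
set X := finmap.enum_fset (fset_set TT).
have NE : counting TT = ((size X)%:R)%:E by rewrite /counting asboolT.
have Xu : uniq X by exact: finmap.fset_uniq.
pose T (i : 'I_(size X)) := tnth (in_tuple X) i.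
have Tinj : injective T by apply/tuple_uniqP.
have TTT i : TT (T i).
  by have := mem_tnth i (in_tuple X); rewrite in_fset_set // inE.
have TTE S : TT S -> exists i, S = T i.
  move=> TS; have : S \in in_tuple X by rewrite /= in_fset_set // inE.
  by move/tnthP => [i ->]; exists i.
have /boolp.choice[av hav] : forall i, exists av : R3 R * R3 R,
    enorm av.2 = 1 /\ T i = tube d av.1 av.2.
  by move=> i; have [[a [v [? ?]]] _] := tubesT _ (TTT i); exists (a, v).
pose a i := (av i).1; pose v i := (av i).2.
have TE i : T i = tube d (a i) (v i) := (hav i).2.
have N0 : (0 < size X)%N by have [i _] := TTE _ TT0; exact: leq_ltn_trans (ltn_ord i).
have {}hN : (size X)%:R <= c24 * (e^-1 * d^-1 ^+ 2).
  move: hN; rewrite NE lee_fin mulr1 => /le_trans; apply.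
  have -> : 8 * 24 ^+ 3 * C1 * (1 / d ^+ 2) = 8 * 24 ^+ 3 * d^-1 ^+ 2 * C1.
    by rewrite exprVn; ring.
  have -> : c24 * (e^-1 * d^-1 ^+ 2) = 8 * 24 ^+ 3 * d^-1 ^+ 2 * (2 / e).
    by rewrite /c24; ring.
  apply: ler_wpM2l C12; rewrite mulr_ge0 ?sqr_ge0 // mulr_ge0 // exprn_ge0 //.
have di0 : 0 < d^-1 by rewrite invr_gt0.
have di1 : 1 <= d^-1 by rewrite invf_ge1.
have edi : e^-1 <= d^-1 by rewrite lef_pV2.
(* Both summands are needed: [L] has to exceed the logarithm of the number of tubes and also the
   number of dyadic scales between [d] and [1]. *)
pose A := (size X)%:R + d^-1.
have Ale : A <= (c24 + 1) * d^-1 ^+ 3.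
  have : c24 * (e^-1 * d^-1 ^+ 2) <= c24 * (d^-1 * d^-1 ^+ 2).
    by rewrite ler_pM2l // ler_pM2r ?exprn_gt0.
  have : d^-1 <= d^-1 ^+ 3 by rewrite -[X in X <= _]expr1 ler_weXn2l.
  rewrite /A mulrDl mul1r -exprS; lra.
have A1 : 1 <= A by apply: le_trans di1 _; rewrite /A lerDr.
have [L L0 [LA1 LA2]] := dyadic_length A1.
have dL : 1 <= 2 ^+ L.-1 * d.
  rewrite -ler_pdivrMr // mul1r; apply: le_trans LA1; by rewrite /A lerDr.
have NL : (size X < 2 ^ L)%N.
  rewrite -(ltr_nat R) natrX; apply: (@lt_le_trans _ _ (2 ^+ L.-1)).
    by apply: lt_le_trans LA1; rewrite /A ltrDl.
  by rewrite ler_weXn2l ?ler1n // leq_pred.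
have hL : L%:R <= cL * e^-1.
  apply: le_trans (log_le_powR b0 LA2) _; rewrite /cL -[X in _ <= X]mulrA.
  apply: ler_wpM2l; first by rewrite invr_ge0 mulr_ge0 ?ln_ge0 ?ler1n // ltW.
  have c40 : 0 <= 4 * (c24 + 1) by rewrite mulr_ge0 // addr_ge0 // ltW.
  apply: (@le_trans _ _ ((4 * (c24 + 1) * d^-1 ^+ 3) `^ b)).
    have q : 4 * A <= 4 * (c24 + 1) * d^-1 ^+ 3 by rewrite -mulrA ler_pM2l.
    have p : 0 <= 4 * A by rewrite mulr_ge0 // (le_trans ler01).
    by apply: ge0_ler_powR; rewrite ?nnegrE ?(ltW b0) // (le_trans p).
  rewrite powRM // ?exprn_ge0 // ?(ltW di0) //.
  suff -> : (d^-1 ^+ 3) `^ b = e^-1 by [].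
  rewrite -powR_mulrn ?(ltW di0) // -[d^-1]powR_inv1 ?(ltW d0) // -!powRrM.
  by rewrite -ei; congr (_ `^ _); rewrite /b; field.
have [f hf] := dyadic_scale d0 L0 dL.
pose bin (i j : 'I_(size X)) := f (enorm (cross3 (v i) (v j))).
have vi1 i : enorm (v i) = 1 := (hav i).1.
have ang1 i j : enorm (cross3 (v i) (v j)) <= 1.
  by apply: le_trans (enorm_cross _ _) _; rewrite !vi1 mulr1.
have Tball i : tube d (a i) (v i) `<=` @unit_ball R.
  by rewrite -TE; exact: (tubesT _ (TTT i)).2.
pose V := fine (vol (\bigcup_(S in TT) Y S)).
have Uball : \bigcup_(S in TT) Y S `<=` @unit_ball R.
  by move=> x [S TS /(YP _ TS).2 Sx]; exact: (tubesT _ TS).2.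
have VE : vol (\bigcup_(S in TT) Y S) = V%:E by rewrite fineK // fin_vol.
have := @volume_bound R 'I_(size X) a v d (c24 / e) L bin d0 d1 vi1 Tball.
have b1 i j : enorm (cross3 (v i) (v j)) <= 2 ^+ bin i j * d by exact: (hf _ (ang1 i j)).1.
have b2 i j : bin i j = 0%N :> nat \/ 2 ^+ bin i j * d <= 2 * enorm (cross3 (v i) (v j)).
  exact: (hf _ (ang1 i j)).2.
have count_le (W : set (R3 R)) (H : {set 'I_(size X)}) :
    (forall i, i \in H -> tube d (a i) (v i) `<=` W) ->
    ((#|H|%:R)%:E <= counting (tubes_in TT W) :> \bar R)%E.
  move=> HW; apply: (@card_le_counting R _ _ T _ H Tinj) => i iH; split; first exact: TTT.
  by rewrite TE; exact: HW.
have plateH p n (r1 : R) a' v' (r2 : R) (H : {set 'I_(size X)}) :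
    0 < r1 -> 0 < r2 -> enorm v' = 1 -> enorm n = 1 -> dot3 v' n = 0 ->
    (forall i, i \in H -> tube d (a i) (v i) `<=` plate p n r1 a' v' r2) ->
    #|H|%:R <= c24 / e * (r1 * r2 / d ^+ 2).
  move=> r10 r20 v'1 n1 vn hH; rewrite -lee_fin; apply: le_trans (count_le _ _ hH) _.
  apply: le_trans (plate_count d0 shaded p a' C10 hC1 r10 r20 v'1 n1 vn) _.
  rewrite lee_fin; apply: ler_wpM2r.
    by apply: divr_ge0; [rewrite ltW // mulr_gt0|rewrite sqr_ge0].
  have -> : c24 / e = 8 * 24 ^+ 3 * (2 / e) by rewrite /c24; ring.
  by apply: ler_wpM2l C12; rewrite mulr_ge0 // exprn_ge0.
have slabH n (c r : R) (H : {set 'I_(size X)}) : enorm n = 1 -> 0 < r ->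
    (forall i, i \in H -> tube d (a i) (v i) `<=` @unit_ball R `&` thicken r (plane n c)) ->
    #|H|%:R <= c24 / e * (r * #|'I_(size X)|%:R).
  move=> n1 r0 hH; rewrite -lee_fin card_ord; apply: le_trans (count_le _ _ hH) _.
  have n0 : n != 0.
    apply/eqP => nz; move: n1; rewrite nz -(scale0r (0 : R3 R)) enormZ normr0 mul0r.
    by move/eqP; rewrite eq_sym oner_eq0.
  have isl : is_slab (@unit_ball R `&` thicken r (plane n c)) by exists n, c, r.
  apply: le_trans (hC2 _ isl) _; rewrite NE.
  have := vol_slab c n0 r0.
  have : vol (@unit_ball R `&` thicken r (plane n c)) \is a fin_num by apply: fin_vol => x [].
  move=> /fineK <-; rewrite lee_fin -!EFinM lee_fin => h.
  rewrite mulrA; apply: ler_wpM2r => //.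
  (* The slab condition leaves a factor [8] to spare, so that one [K] serves plates and slabs. *)
  have -> : c24 / e * r = 2 / e * (8 * (24 ^+ 3 * r)) by rewrite /c24; ring.
  apply: ler_pM => //; [exact: ltW|exact: fine_ge0 (vol_ge0 _)|].
  have : 0 <= 24 ^+ 3 * r by rewrite mulr_ge0 ?exprn_ge0 // ltW.
  lra.
have finsum (F : set (R3 R) -> \bar R) : (forall S, 0 <= F S)%E ->
    \esum_(S in TT) F S = (\sum_(i < size X) F (T i))%E.
  move=> F0; rewrite esum_fset // fsbig_finite //.
  exact: (big_tnth _ _ X xpredT F).
have binC i j : bin i j = bin j i by rewrite /bin crossC_norm.
have YTball i : Y (T i) `<=` @unit_ball R.
  exact: subset_trans (YP _ (TTT i)).2 (tubesT _ (TTT i)).2.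
(* The density is stated through tube volumes; their lower bound [d ^+ 2 / 8] accounts for the
   [8]. *)
have hdense : e / 8 * (#|'I_(size X)|%:R * d ^+ 2) <= \sum_i fine (vol (Y (T i))).
  move: dense; rewrite /dense_shading !finsum; try by move=> S; exact: vol_ge0.
  under [X in (_ <= X)%E]eq_bigr => i _ do rewrite -(fineK (fin_vol (@YTball i))).
  rewrite sumEFin -lee_fin; apply: le_trans.
  have -> : (e / 8 * (#|'I_(size X)|%:R * d ^+ 2))%:E =
      (e%:E * \sum_(i < size X) (d ^+ 2 / 8)%:E)%E.
    by rewrite sumEFin -EFinM sumr_const -[_ *+ #|_|]mulr_natl; congr (_%:E); ring.
  apply: lee_pmul => //; rewrite ?lee_fin ?(ltW e0) //.
    by apply: sume_ge0 => i _; rewrite lee_fin divr_ge0 // sqr_ge0.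
  by apply: lee_sum => i _; rewrite TE; exact: vol_tube_ge.
have hV : (vol (\bigcup_i Y (T i)) <= V%:E)%E.
  by rewrite -VE; apply: le_vol => x [i _ Yx]; exists (T i).
move=> /(_ b1 b2 plateH binC slabH (e / 8) V (Y \o T)).
have -> : fine (counting TT) = (size X)%:R :> R by rewrite NE.
rewrite -[fine (vol _)]/V card_ord => vb.
have {}vb : (e / 8) ^+ 6 * ((size X)%:R * d ^+ 3) <=
    C0 * (L%:R ^+ 18 * ((c24 / e) ^+ 2 * V ^+ 2)).
  apply: vb => //.
  - by move=> i; exact: (YP _ (TTT i)).1.
  - by move=> i; rewrite -TE; exact: (YP _ (TTT i)).2.
  - by rewrite divr_gt0.
  - lra.
  - by move: hdense; rewrite card_ord.
have hL18 : L%:R ^+ 18 <= (cL * e^-1) ^+ 18.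
  apply: lerXn2r hL; first by rewrite nnegrE ler0n.
  by rewrite nnegrE ltW // mulr_gt0.
have r0 : 0 <= C0 * ((c24 / e) ^+ 2 * V ^+ 2).
  by apply: mulr_ge0; [exact: ltW|apply: mulr_ge0; exact: sqr_ge0].
have p8 : 0 <= 8 ^+ 6 * e ^+ 20 by apply: mulr_ge0; apply: exprn_ge0 => //; exact: ltW.
have step : (e / 8) ^+ 6 * ((size X)%:R * d ^+ 3) <=
    (cL * e^-1) ^+ 18 * (C0 * ((c24 / e) ^+ 2 * V ^+ 2)).
  by apply: le_trans vb _; rewrite mulrCA; exact: ler_wpM2r.
have := ler_wpM2l p8 step; congr (_ <= _).
  by field.
by field; exact: lt0r_neq0.
Qed.

Theorem proposition1p8 (R : realType) :
  forall eps : R, 0 < eps ->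
  exists kappa eta : R, [/\ 0 < kappa, 0 < eta &
    forall delta : R, 0 < delta ->
    forall (TT : set (set (R3 R))) (Y : set (R3 R) -> set (R3 R)),
      shaded_tubes delta TT Y ->
      dense_shading (delta `^ eta) TT Y ->
      (C_KT_CW delta TT <= (delta `^ (- eta))%:E)%E ->
      (C_F_SW TT <= (delta `^ (- eta))%:E)%E ->
      let N : R := fine (counting TT) in
      let v := tube_vol delta in
      ((kappa * delta `^ eps * (N * v)
          * (N * v `^ (1 / 2)) `^ (- (1 / 2)))%:E
        <= vol (\bigcup_(T in TT) Y T))%E].
Proof.
(* [volume_estimate] bounds the square of the volume with a loss of [26 * eta] in the exponent; the
   square root leaves [13 * eta], to be at most [eps]. *)
move=> eps eps0; pose eta := Num.min 1 (eps / 13).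
have eta0 : 0 < eta by rewrite lt_min ltr01 divr_gt0.
have eta1 : eta <= 1 by rewrite ge_min lexx.
have eta13 : 13 * eta <= eps.
  have : eta <= eps / 13 by rewrite ge_min lexx orbT.
  lra.
have [C C0 hC] := volume_estimate eta0 eta1.
have c0 : 0 < 12 ^+ 6 * C by rewrite mulr_gt0 // exprn_gt0.
exists (Num.sqrt (12 ^+ 6 * C))^-1, eta; split=> //; first by rewrite invr_gt0 sqrtr_gt0.
move=> d d0 TT Y shaded dense KT FS; cbv zeta.
set N := fine (counting TT); set v := tube_vol d.
have d1 := tube_radius_le1 d0 shaded; have [v8 v12] := tube_vol_bounds d0 d1.
have v0 : 0 < v by apply: lt_le_trans v8; rewrite divr_gt0 // exprn_gt0.
have := hC d TT Y d0 shaded dense KT FS; rewrite -/N => main.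
have [_ tubesT _ YP] := shaded.
have Uball : \bigcup_(S in TT) Y S `<=` @unit_ball R.
  by move=> x [S TS /(YP _ TS).2 Sx]; exact: (tubesT _ TS).2.
rewrite -(fineK (fin_vol Uball)) lee_fin.
set V := fine (vol _) in main *; have V0 : 0 <= V by exact: fine_ge0 (vol_ge0 _).
have N0 : 0 <= N.
  by rewrite /N /counting; case: ifP => //= _; rewrite ler0n.
(* With [N = 0], which is also the value of [fine] at infinity, the lower bound is [0]. *)
have [NZ|NZ] := eqVneq N 0; first by rewrite NZ mul0r mulr0 mul0r.
have {NZ}N0 : 0 < N by rewrite lt_def NZ.
set q := v `^ (1 / 2).
have q0 : 0 < q by exact: powR_gt0.
have hf (x : R) : 0 <= x -> (x `^ (1 / 2)) ^+ 2 = x.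
  by move=> x0; rewrite div1r powR12_sqrt // sqr_sqrtr.
have q2 : q ^+ 2 = v by apply: hf; exact: ltW.
have q12 : q <= 12 ^+ 2 * d.
  rewrite -ler_sqr ?nnegrE ?mulr_ge0 ?exprn_ge0 ?(ltW q0) ?(ltW d0) // q2.
  by rewrite exprMn -exprM.
set w := (N * q) `^ (- (1 / 2)).
have w0 : 0 < w by apply: powR_gt0; exact: mulr_gt0.
have w2 : w ^+ 2 = (N * q)^-1.
  by rewrite /w powRN exprVn hf // ltW // mulr_gt0.
set e := d `^ eta in main; have e0 : 0 < e by exact: powR_gt0.
have de : d `^ eps <= e ^+ 13.
  rewrite -powR_mulrn ?(ltW e0) // /e -powRrM mulrC.
  by apply: powR_anti => //.
set k := Num.sqrt _; have k0 : 0 < k by rewrite sqrtr_gt0.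
have k2 : k ^+ 2 = 12 ^+ 6 * C by rewrite sqr_sqrtr // ltW.
rewrite -!mulrA mulrC ler_pdivrMr //.
(* Since [v = q ^+ 2] and [w ^+ 2 = (N * q)^-1], the square is [N * q ^+ 3], and [q] is comparable
   to [d]. *)
have X2 : (N * v * w) ^+ 2 <= 12 ^+ 6 * (N * d ^+ 3).
  have -> : (N * v * w) ^+ 2 = N * q ^+ 3.
    rewrite exprMn w2 -q2; field.
    by rewrite !lt0r_neq0.
  rewrite [X in _ <= X]mulrCA ler_pM2l //.
  have -> : 12 ^+ 6 * d ^+ 3 = (12 ^+ 2 * d) ^+ 3 by ring.
  by apply: lerXn2r q12; rewrite nnegrE ?mulr_ge0 ?exprn_ge0 ?(ltW q0) ?(ltW d0).
have X0 : 0 <= N * v * w by rewrite !mulr_ge0 // ltW.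
apply: (@le_trans _ _ (e ^+ 13 * (N * v * w))).
  by have := ler_wpM2r X0 de; congr (_ <= _); ring.
rewrite -ler_sqr ?nnegrE ?mulr_ge0 ?exprn_ge0 ?(ltW e0) ?(ltW k0) ?(ltW N0) ?(ltW v0) ?(ltW w0) //.
rewrite [X in _ <= X]exprMn k2 exprMn -exprM.
have e26 : 0 <= e ^+ (13 * 2) by rewrite exprn_ge0 // ltW.
apply: le_trans (ler_wpM2l e26 X2) _.
have c12 : 0 <= 12 ^+ 6 :> R by exact: exprn_ge0.
by have := ler_wpM2l c12 main; congr (_ <= _); ring.
Qed.
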